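(* Let $x,b>0$ and $a_1,a_2,a_3,a_4>0$ with $a_1+a_4>1$ and $a_2+a_3>1$. Let $u^t$ and $w^t$ be two instances, started at $u^0$ and $w^0$ in $(0,\infty)$ with $u^0\le w^0$, of the Markov chain on $(0,\infty)$ $$u^{t+1}=\frac{\gamma_2^{t+1}}{\frac{\gamma_1^{t+1}}{u^t+x}+\frac{\gamma_3^{t+1}}{u^t+b}},$$ where $\{\gamma_i^t:t\ge1,\ i=1,2,3\}$ are independent with $\gamma_i^t\sim\Gamma(a_i+a_{i+1},1)$. Put $R_0=w^0/u^0$ and $J_0=u^0+1/u^0$, and let $\eta,\beta,r,d$ be the constants defined in the context. Then for every integer $t\ge0$, $$d_{TV}(u^{t+2},w^{t+2})\le r^{t/(2d)}\left(1+3(a_2+a_3)(R_0-1)\right)+\frac{\max\{J_0,\eta\}\,\beta^{\lfloor t/2\rfloor+3}}{\eta}.$$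
   Context: $\Gamma(\alpha,\lambda)$ is the Gamma distribution with shape $\alpha$ and inverse scale (rate) $\lambda$. $d_{TV}(X,Y)=\sup_A|\mathbb{P}(X\in A)-\mathbb{P}(Y\in A)|$ is the total variation distance between the laws of $X$ and $Y$. Constants: $$\zeta=\frac{a_2+a_3}{a_1+a_2+a_3+a_4-1},\qquad \beta=\frac{1+\zeta}{2},$$ $$\eta=\frac{2}{1-\zeta}\left(\frac{(x+b)(a_2+a_3)}{a_1+a_2+a_3+a_4-1}+\frac{(a_1+a_2)/x+(a_3+a_4)/b}{a_2+a_3-1}\right),$$ $$r=1-\frac{\min\{x,b\}}{2\max\{x,b\}+\eta\left(1+\max\{x,b\}^2\right)},\qquad d=\max\left\{3,\ \frac{\ln(\beta\,|\ln\beta|\,r/2)}{\ln\beta}\right\}.$$ *)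

(* Defs.v *)
From HB Require Import structures.
From mathcomp Require Export all_boot all_order all_algebra finmap.
From mathcomp Require Export all_classical all_reals all_analysis.

Set Implicit Arguments.
Unset Strict Implicit.
Unset Printing Implicit Defensive.

Import Order.TTheory GRing.Theory Num.Theory.
Import numFieldNormedType.Exports.

Local Open Scope classical_set_scope.
Local Open Scope ring_scope.

Section gamma_distribution.
Context {R : realType}.

Definition gamma_fun (a : R) : R :=
  \int[lebesgue_measure]_(s in `]0, +oo[) (s `^ (a - 1) * expR (- s)).

(* [l] is the rate (inverse scale). *)
Definition gamma_pdf (a l : R) : R -> R :=
  (fun s => l `^ a / gamma_fun a * s `^ (a - 1) * expR (- (l * s)))
    \_ `]0, +oo[.

Definition gamma_prob (a l : R) (A : set R) : \bar R :=
  (\int[lebesgue_measure]_(s in A) (gamma_pdf a l s)%:E)%E.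

End gamma_distribution.

Definition has_gamma_law {d} {T : measurableType d} {R : realType}
    (P : probability T R) (X : {RV P >-> R}) (a l : R) : Prop :=
  forall A : set R, measurable A -> distribution P X A = gamma_prob a l A.

(* Mutual independence of the subfamily of [X] indexed by [D]. *)
Definition mutually_independent {d} {T : measurableType d} {R : realType}
    (P : probability T R) {I : choiceType} (D : set I)
    (X : I -> {RV P >-> R}) : Prop :=
  forall (F : {fset I}) (A : I -> set R),
    [set` F] `<=` D -> (forall i, measurable (A i)) ->
    P (\bigcap_(i in [set` F]) X i @^-1` A i) =
      (\prod_(i <- F) P (X i @^-1` A i))%E.

(* The supremum is over Borel sets; [X] and [Y] may live on different
   probability spaces, since only their laws matter. *)
Definition dTV {d1 d2} {T1 : measurableType d1} {T2 : measurableType d2}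
    {R : realType} (P : probability T1 R) (Q : probability T2 R)
    (X : {RV P >-> R}) (Y : {RV Q >-> R}) : \bar R :=
  ereal_sup [set `|P (X @^-1` A) - Q (Y @^-1` A)|%E | A in @measurable _ R].

(* [gam t i] is meaningful only for [1 <= t] and [1 <= i <= 3]; nothing is
   required of the other values. *)
Definition gamma_noise {d} {T : measurableType d} {R : realType}
    (P : probability T R) (a1 a2 a3 a4 : R)
    (gam : nat -> nat -> {RV P >-> R}) : Prop :=
  mutually_independent
    [set p : nat * nat | (1 <= p.1)%N /\ (1 <= p.2 <= 3)%N]
    (fun p => gam p.1 p.2) /\
  (forall t, (1 <= t)%N ->
    [/\ has_gamma_law (gam t 1%N) (a1 + a2) 1,
        has_gamma_law (gam t 2%N) (a2 + a3) 1 &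
        has_gamma_law (gam t 3%N) (a3 + a4) 1]).

(* The equations are only required almost surely: the noise, hence the chain,
   may leave ]0, +oo[ on a null set. *)
Definition is_chain {d} {T : measurableType d} {R : realType}
    (P : probability T R) (x b u0 : R)
    (gam : nat -> nat -> {RV P >-> R}) (u : nat -> {RV P >-> R}) : Prop :=
  {ae P, forall om, u 0%N om = u0} /\
  forall t, {ae P, forall om,
    u t.+1 om = gam t.+1 2%N om /
      (gam t.+1 1%N om / (u t om + x) + gam t.+1 3%N om / (u t om + b))}.

Section constants.
Context {R : realType}.
Variables x b a1 a2 a3 a4 : R.

Definition czeta : R := (a2 + a3) / (a1 + a2 + a3 + a4 - 1).

Definition cbeta : R := (1 + czeta) / 2.

Definition ceta : R :=
  2 / (1 - czeta) *
  ((x + b) * (a2 + a3) / (a1 + a2 + a3 + a4 - 1) +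
   ((a1 + a2) / x + (a3 + a4) / b) / (a2 + a3 - 1)).

Definition cr : R :=
  1 - Num.min x b /
      (2 * Num.max x b + ceta * (1 + Num.max x b ^+ 2)).

Definition cd : R :=
  Num.max 3 (ln (cbeta * `|ln cbeta| * cr / 2) / ln cbeta).

End constants.

(* Main.v *)
From HB Require Import structures.
Require Import Defs.
From mathcomp Require Import measurable_realfun random_variable exponential_distribution.
From mathcomp Require Import ring lra zify.

(* Run the two chains with the same noise. Then [w_t >= u_t], the ratio
   [w_t / u_t] never increases, and one step multiplies [w_t / u_t - 1] by at
   most [u_t / (u_t + min x b)], which is at most [r] when [J u_t <= eta], where
   [J u = u + 1 / u]. The drift [E (J u_(t+1)) <= beta * max (J u_t) eta], which
   comes from the moments of the Gamma laws, makes the chain reach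
   [{J <= eta}] geometrically fast and then return to it at each step with
   probability at least [1 - beta], so that the number of visits dominates a
   binomial variable. In the last step the two chains are instead coupled by
   rescaling [gamma_2], whose shape is [s = a2 + a3]: for [k >= 1] the law of
   [k * gamma_2] dominates [k ^ (- s)] times that of [gamma_2], hence a total
   variation error of at most [s * (k - 1)]. Half of the time is spent on waiting for the
   first visit, half on contracting; the definition of [d] gives
   [((1 + beta) / 2) ^ d <= r / 2], which balances the two. *)

Set Implicit Arguments.
Unset Strict Implicit.
Unset Printing Implicit Defensive.

Import Order.TTheory GRing.Theory Num.Theory.
Import numFieldNormedType.Exports.

Local Open Scope classical_set_scope.
Local Open Scope ring_scope.

(** * Densities and Gamma laws *)

(** No joint process is built: the two chains may live on different probability spaces, and only
    their laws enter. Write [K h u] for the mean of [h (step x b u g)] over the noise [g]. Both laws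
    are iterates of [K] applied to an indicator, and the coupling becomes an inequality
    [iter k K f u <= iter k K f w + error] for [u <= w] and [f] with values between 0 and 1.
    Induction on [k] carries it, using the same [g] on both sides; visits and waiting times survive
    only in the shape of the error term. The rate [(1 + beta) / 2] is the mean of [(1/2) ^ V] for a
    Bernoulli variable [V] with success probability [1 - beta].

    The Gamma laws are handled through a single scaling identity. Together with total mass one it
    gives the Laplace transform, from which the mean and the inverse moment are extracted. *)

Section density.
Import HBNNSimple.
Local Open Scope ereal_scope.
Context d (T : measurableType d) (R : realType).
Variables (mu nu : {measure set T -> \bar R}) (h : T -> R).
Hypotheses (mh : measurable_fun setT h) (h0 : forall x, (0 <= h x)%R).
Hypothesis nuE :
  forall A, measurable A -> nu A = \int[mu]_(x in A) (h x)%:E.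

(** The density describes [nu] on sets only; simple functions and monotone convergence carry this to
    nonnegative integrands. *)
Lemma ge0_integral_density (f : T -> \bar R) :
  measurable_fun setT f -> (forall x, 0 <= f x) ->
  \int[nu]_x f x = \int[mu]_x (f x * (h x)%:E).
Proof.
move=> mf f0.
have mhE : measurable_fun setT (EFin \o h) by exact/measurable_EFinP.
pose f_ := nnsfun_approx measurableT mf.
have nd x : {homo (fun n => f_ n x) : a b / (a <= b)%N >-> (a <= b)%R}.
  by move=> a b ab; exact/lefP/nd_nnsfun_approx.
have cf x : (f_ n x)%:E @[n --> \oo] --> f x.
  by apply: cvg_nnsfun_approx => // *; exact: f0.
transitivity (limn (fun n => \int[nu]_x (f_ n x)%:E)).
  rewrite -monotone_convergence//.
  - by apply: eq_integral => y _; exact/esym/cvg_lim.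
  - by move=> n; exact/measurable_EFinP/measurable_funP.
  - by move=> n y _; rewrite lee_fin.
  - by move=> y _ m n mn; rewrite lee_fin; exact: nd.
transitivity (limn (fun n => \int[mu]_x ((f_ n x)%:E * (h x)%:E))); last first.
  rewrite -monotone_convergence//.
  - by apply: eq_integral => y _; apply/cvg_lim => //; exact: cvgeZr.
  - move=> n; apply: emeasurable_funM => //.
    exact/measurable_EFinP/measurable_funP.
  - by move=> n y _; rewrite -EFinM lee_fin mulr_ge0.
  - by move=> y _ m n mn; rewrite -!EFinM lee_fin ler_wpM2r// nd.
congr (limn _); apply/funext => n.
have mfn r : measurable (f_ n @^-1` [set r]) by [].
have k0 r y : (0 <= r * \1_(f_ n @^-1` [set r]) y)%R.
  by rewrite -lee_fin EFinM nnfun_muleindic_ge0.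
under eq_integral do rewrite fimfunE -fsumEFin//.
rewrite ge0_integral_fsum//; last 2 first.
- by move=> r; exact/measurable_EFinP/measurable_funM.
- by move=> r y _; rewrite ?lee_fin k0.
under [RHS]eq_integral => y _.
  rewrite fimfunE -fsumEFin//.
  rewrite ge0_mule_fsuml; last by move=> r; rewrite ?lee_fin k0.
  over.
rewrite [RHS]ge0_integral_fsum//; last 2 first.
- move=> r; apply: emeasurable_funM => //.
  exact/measurable_EFinP/measurable_funM.
- by move=> r y _; rewrite mule_ge0// ?lee_fin ?k0.
apply: eq_fsbigr => r _; rewrite integralZl_indic_nnsfun// integral_indic//=.
rewrite setIT nuE//.
have [r0|r0] := leP 0%R r; last first.
  rewrite preimage_nnfun0//= integral_set0 mule0.
  by rewrite integral0_eq// => y _; rewrite indic0 mulr0 mul0e.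
rewrite -ge0_integralZl//; last 2 first.
- exact: measurable_funTS.
- by move=> y _; rewrite lee_fin.
rewrite integral_mkcond; apply: eq_integral => y _.
rewrite patchE indicE; case: ifPn => _.
  by rewrite mulr1.
by rewrite mulr0 mul0e.
Qed.
End density.

Section scaling.
Local Open Scope ereal_scope.
Context {R : realType}.
Local Notation mu := (@lebesgue_measure R).
Variables (k : R) (k0 : (0 < k)%R).
Local Notation scale := (fun x : measurableTypeR R => (k * x)%R : measurableTypeR R).

Let mscale_fun : measurable_fun setT scale.
Proof. exact: measurable_funM. Qed.


(** Pushing forward by [x -> k * x] divides the length of an interval by [k]; the factor [k]
    restores it. *)
Let scaled_lebesgue : {measure set (measurableTypeR R) -> \bar R} :=
  mscale (NngNum (ltW k0))
    (@measure_function_pushforward__canonical__measure_function_Measure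
       _ _ _ _ _ mu scale mscale_fun).

Lemma lebesgue_measure_scale (A : set R) : measurable A ->
  mu A = k%:E * mu ((fun x => k * x)%R @^-1` A).
Proof.
move=> mA; rewrite -[RHS]/(scaled_lebesgue A).
apply: lebesgue_measure_unique => //= _ [[a b] _ <-].
rewrite -[RHS]/(k%:E * mu ((fun x => k * x)%R @^-1` `]a, b])).
rewrite (_ : (fun x => k * x)%R @^-1` `]a, b]%classic =
    `](k^-1 * a)%R, (k^-1 * b)%R]%classic); last first.
  by apply/seteqP; split => x /=; rewrite !in_itv/= ltr_pdivrMl// ler_pdivlMl.
rewrite !lebesgue_measure_itv/= !lte_fin ltr_pM2l ?invr_gt0//.
case: ifPn => _; last by rewrite mule0.
by rewrite -!EFinB -EFinM -mulrBr mulVKf// gt_eqF.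
Qed.

Lemma ge0_integral_scale (f : R -> \bar R) :
  measurable_fun setT f -> (forall x, 0 <= f x) ->
  \int[mu]_x f x = k%:E * \int[mu]_x f (k * x)%R.
Proof.
move=> mf f0.
transitivity (\int[scaled_lebesgue]_x f x).
  by apply: eq_measure_integral => A mA _; exact: lebesgue_measure_scale.
rewrite /scaled_lebesgue ge0_integral_mscale//; congr (_ * _).
by rewrite (ge0_integral_pushforward mscale_fun).
Qed.

End scaling.

Section gamma.
Local Open Scope ereal_scope.
Context {R : realType}.
Local Notation mu := (@lebesgue_measure R).
Variable a : R.

Lemma gamma_fun_ge0 : (0 <= gamma_fun a)%R.
Proof.
by apply: Rintegral_ge0 => s _; rewrite mulr_ge0// ?powR_ge0// expR_ge0.
Qed.

Lemma gamma_pdf_ge0 l s : (0 <= gamma_pdf a l s)%R.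
Proof.
rewrite /gamma_pdf patchE; case: ifPn => // _.
by rewrite !mulr_ge0// ?powR_ge0 ?expR_ge0// invr_ge0 gamma_fun_ge0.
Qed.

Lemma measurable_gamma_pdf l : measurable_fun setT (gamma_pdf a l).
Proof.
apply/(measurable_restrictT _ _).1 => //.
apply: measurable_funM; last first.
  by apply: measurableT_comp => //; apply: measurableT_comp.
apply: measurable_funM => //.
exact: measurable_funTS.
Qed.

End gamma.

Section gamma_law.
Local Open Scope ereal_scope.
Context {R : realType}.
Local Notation mu := (@lebesgue_measure R).
Variables (a : R) (nu : {measure set R -> \bar R}).
Hypothesis nuE : forall A : set R, measurable A -> nu A = gamma_prob a 1 A.

(** The identity moves [nu] to the measurable type that carries Lebesgue measure. *)
Let idR : R -> measurableTypeR R := idfun.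

Let measurable_idR : measurable_fun setT idR.
Proof. by move=> _ A mA; rewrite setTI. Qed.

Let nuR : {measure set (measurableTypeR R) -> \bar R} :=
  @measure_function_pushforward__canonical__measure_function_Measure
       _ _ _ _ _ nu idR measurable_idR.

Lemma integral_gamma_law (f : R -> \bar R) :
  measurable_fun setT f -> (forall x, 0 <= f x) ->
  \int[nu]_x f x = \int[mu]_x (f x * (gamma_pdf a 1 x)%:E).
Proof.
move=> mf f0.
rewrite -(@ge0_integral_density _ _ _ _ nuR _ (measurable_gamma_pdf a 1)
  (gamma_pdf_ge0 a 1) nuE f mf f0).
by rewrite (ge0_integral_pushforward measurable_idR).
Qed.

Lemma gamma_law_pos : nu (~` `]0%R, +oo[) = 0.
Proof.
rewrite nuE; last exact: measurableC.
rewrite /gamma_prob; apply: integral0_eq => s /= s0.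
by rewrite /gamma_pdf patchE memNset.
Qed.

Lemma gamma_pdfE (s : R) : gamma_pdf a 1 s =
  if (0 < s)%R then ((gamma_fun a)^-1 * s `^ (a - 1) * expR (- s))%R else 0%R.
Proof.
rewrite /gamma_pdf patchE powR1 !mul1r.
case: ifPn => s0; move: s0; rewrite ?inE ?notin_setE/= in_itv/= andbT.
  by move=> ->.
by move=> /negP/negbTE ->.
Qed.

Lemma gamma_pdf_scale (k s : R) : (0 < k)%R ->
  gamma_pdf a 1 (k * s)%R =
  (k `^ (a - 1) * expR ((1 - k) * s) * gamma_pdf a 1 s)%R.
Proof.
move=> k0; rewrite !gamma_pdfE pmulr_rgt0//; case: ifPn => s0; last by rewrite mulr0.
rewrite powRM ?ltW// (_ : - (k * s) = - s + (1 - k) * s)%R; last by ring.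
by rewrite expRD; ring.
Qed.

(** Substituting [k * s] multiplies the density by [k ^ (a - 1) * exp ((1 - k) * s)], and the
    Jacobian supplies one more [k]. Domination under dilation and the Laplace transform are both
    instances. *)
Lemma gamma_law_scale (k : R) (f : R -> \bar R) : (0 < k)%R ->
  measurable_fun setT f -> (forall x, 0 <= f x) ->
  \int[nu]_s f s =
  (k `^ a)%:E * \int[nu]_s (f (k * s)%R * (expR ((1 - k) * s))%:E).
Proof.
move=> k0 mf f0.
have mfk : measurable_fun setT (fun s => f (k * s)%R).
  by apply: measurableT_comp => //; exact: measurable_funM.
have me : measurable_fun setT (fun s => (expR ((1 - k) * s))%:E).
  by apply/measurable_EFinP; do 2 apply: measurableT_comp => //.
have mp : measurable_fun setT (EFin \o gamma_pdf a 1).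
  by apply/measurable_EFinP; exact: measurable_gamma_pdf.
have ef0 x : 0 <= f (k * x)%R * (expR ((1 - k) * x))%:E.
  by rewrite mule_ge0// lee_fin expR_ge0.
rewrite integral_gamma_law// integral_gamma_law//; last exact: emeasurable_funM.
rewrite [LHS](ge0_integral_scale k0); last 2 first.
- exact: emeasurable_funM.
- by move=> x; rewrite mule_ge0// lee_fin gamma_pdf_ge0.
transitivity (k%:E * ((k `^ (a - 1))%:E * \int[mu]_x
   (f (k * x)%R * (expR ((1 - k) * x))%:E * (gamma_pdf a 1 x)%:E))).
  congr (_ * _); rewrite -ge0_integralZl//; last 3 first.
  - by apply: emeasurable_funM => //; exact: emeasurable_funM.
  - by move=> x _; rewrite mule_ge0// lee_fin gamma_pdf_ge0.
  - by rewrite lee_fin powR_ge0.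
  apply: eq_integral => x _; rewrite gamma_pdf_scale// !EFinM.
  rewrite !muleA; congr (_ * _); rewrite -!muleA muleC -!muleA; congr (_ * _).
  by rewrite muleC.
rewrite muleA -EFinM -{1}(powRr1 (ltW k0)) -powRD ?(gt_eqF k0) ?implybT//.
by rewrite addrC subrK.
Qed.

(** Scaling by [k^-1] in the integral of [h (k * s)] produces the weight [exp ((1 - k^-1) * s)],
    which is at least 1 on [s > 0], where the law lives. *)
Lemma gamma_law_dilate (k : R) (h : R -> \bar R) : (1 <= k)%R ->
  measurable_fun setT h -> (forall x, 0 <= h x) ->
  (k `^ (- a))%:E * \int[nu]_s h s <= \int[nu]_s h (k * s)%R.
Proof.
move=> k1 mh h0; have k0 : (0 < k)%R by exact: lt_le_trans k1.
have ki0 : (0 < k^-1)%R by rewrite invr_gt0.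
have mhk : measurable_fun setT (fun s => h (k * s)%R).
  by apply: measurableT_comp => //; exact: measurable_funM.
have me : measurable_fun setT (fun s => (expR ((1 - k^-1) * s))%:E).
  by apply/measurable_EFinP; do 2 apply: measurableT_comp => //.
rewrite [leRHS](gamma_law_scale ki0)//.
have -> : (k^-1 `^ a = k `^ (- a))%R.
  by rewrite -powR_inv1 ?ltW// -powRrM mulN1r.
apply: lee_wpmul2l; first by rewrite lee_fin powR_ge0.
under [leRHS]eq_integral do rewrite mulVKf ?gt_eqF//.
rewrite !integral_gamma_law//; last 2 first.
- exact: emeasurable_funM.
- by move=> s; rewrite mule_ge0// lee_fin expR_ge0.
have mp : measurable_fun setT (EFin \o gamma_pdf a 1).
  by apply/measurable_EFinP; exact: measurable_gamma_pdf.
apply: ge0_le_integral => //.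
- by move=> s _; rewrite mule_ge0// lee_fin gamma_pdf_ge0.
- exact: emeasurable_funM.
- by apply: emeasurable_funM => //; exact: emeasurable_funM.
move=> s _; rewrite -muleA; apply: lee_wpmul2l => //.
rewrite -EFinM lee_fin; have [s0|s0] := ltP 0%R s.
  rewrite ler_peMl ?gamma_pdf_ge0//; apply: le_trans (expR_ge1Dx _).
  by rewrite lerDl mulr_ge0 ?(ltW s0)// subr_ge0 invf_le1.
by rewrite gamma_pdfE ltNge s0 mulr0.
Qed.

Hypothesis nu1 : nu setT = 1.

(** Scaling by [(1 + v)^-1] makes the two exponentials cancel and leaves the total mass. *)
Lemma gamma_law_laplace (v : R) : (-1 < v)%R ->
  \int[nu]_s (expR (- (v * s)))%:E = ((1 + v) `^ (- a))%:E.
Proof.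
move=> v0; have v1 : (0 < 1 + v)%R by rewrite addrC -ltrBlDr sub0r.
have me : measurable_fun setT (fun s => (expR (- (v * s)))%:E).
  apply/measurable_EFinP; apply: measurableT_comp => //.
  by apply: measurableT_comp => //.
have vi : (0 < (1 + v)^-1)%R by rewrite invr_gt0.
rewrite (gamma_law_scale vi)//.
under eq_integral => s _.
  rewrite -EFinM -expRD (_ : _ + _ = 0)%R ?expR0; last by field; rewrite gt_eqF.
  over.
rewrite integral_cst//= nu1 mule1 mule1.
by rewrite -powR_inv1 ?ltW// -powRrM mulN1r.
Qed.
End gamma_law.

(* [pos] modifies a gamma variable only on the null set where it is
   nonpositive, so that all later pointwise estimates hold everywhere. *)
Definition pos {R : realType} (s : R) : R := if 0 < s then s else 1.

Section pos.
Local Open Scope ereal_scope.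
Context {R : realType}.

Lemma pos_gt0 (s : R) : (0 < pos s)%R.
Proof. by rewrite /pos; case: ifPn. Qed.

Lemma pos_id (s : R) : (0 < s)%R -> pos s = s.
Proof. by rewrite /pos => ->. Qed.

Lemma measurable_pos : measurable_fun setT (@pos R).
Proof.
apply: measurable_fun_ifT => //.
exact: measurable_fun_ltr.
Qed.

Lemma integral_pos (a : R) (nu : {measure set R -> \bar R}) (f : R -> \bar R) :
  (forall A : set R, measurable A -> nu A = gamma_prob a 1 A) ->
  measurable_fun setT f -> (forall x, 0 <= f x) ->
  \int[nu]_s f (pos s) = \int[nu]_s f s.
Proof.
move=> nuE mf f0; rewrite !(integral_gamma_law nuE)//; last first.
  by apply: measurableT_comp => //; exact: measurable_pos.
apply: eq_integral => s _; rewrite gamma_pdfE /pos.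
by case: ifPn => // _; rewrite !mule0.
Qed.
End pos.

(** * Moments from the Laplace transform *)

Section moments.
Local Open Scope ereal_scope.
Context {R : realType}.
Local Notation mu := (@lebesgue_measure R).

Lemma integral_expR_itvy (s : R) : (0 < s)%R ->
  \int[mu]_(v in `[0%R, +oo[) (expR (- (v * s)))%:E = (s^-1)%:E.
Proof.
move=> s0; have := integral_exponential_pdf s0.
rewrite (_ : \int[mu]_x _ =
    \int[mu]_(v in `[0%R, +oo[) (s%:E * (expR (- (v * s)))%:E)); last first.
  rewrite [RHS]integral_mkcond; apply: eq_integral => v _.
  rewrite /exponential_pdf !patchE; case: ifPn => // _.
  by rewrite -EFinM mulNr (mulrC s v).
rewrite ge0_integralZl//; last 2 first.
- apply/measurable_EFinP/measurable_funTS; apply: measurableT_comp => //.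
  by apply: measurable_funN; exact: measurable_funM.
- by rewrite lee_fin ltW.
move=> /(congr1 (fun z => (s^-1)%:E * z)).
by rewrite muleA -EFinM mulVf ?gt_eqF// mul1e mule1.
Qed.

Lemma cvgy_powRN (a : R) : (0 < a)%R -> ((1 + v) `^ (- a))%R @[v --> +oo%R] --> (0 : R)%R.
Proof.
move=> a0; apply/cvgrPdist_le => /= e e0.
near=> v.
rewrite sub0r normrN ger0_norm ?powR_ge0// powRN.
rewrite -[leRHS]invrK lef_pV2 ?posrE ?powR_gt0 ?invr_gt0//; last first.
  by rewrite ltr_pwDl//; near: v; exact: nbhs_pinfty_ge.
have v0 : (e `^ (- a^-1) <= 1 + v)%R.
  by apply: (@le_trans _ _ v); rewrite ?lerDr//; near: v; exact: nbhs_pinfty_ge.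
have -> : (e^-1 = (e `^ (- a^-1)) `^ a)%R.
  by rewrite -powRrM mulNr mulVf ?gt_eqF// powR_inv1// ltW.
by rewrite ge0_ler_powR ?nnegrE ?powR_ge0 ?(ltW a0)// (le_trans _ v0)// powR_ge0.
Unshelve. all: by end_near. Qed.

Lemma integral_powR_itvy (a : R) : (1 < a)%R ->
  \int[mu]_(v in `[0%R, +oo[) ((1 + v) `^ (- a))%:E = ((a - 1)^-1)%:E.
Proof.
move=> a1; have a10 : (0 < a - 1)%R by rewrite subr_gt0.
have dP (e v : R) : (-1 < v)%R ->
    is_derive v 1%R (fun v => (1 + v) `^ e)%R (e * (1 + v) `^ (e - 1))%R.
  move=> v1; have v10 : (0 < 1 + v)%R by rewrite addrC -ltrBlDr sub0r.
  apply: is_derive_eq.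
    apply: (@is_derive1_comp _ (fun x => x `^ e)%R (fun v => 1 + v)%R).
    exact: is_derive1_powR.
  by rewrite add0r !mulr1.
have v0N1 (v : R) : (0 <= v)%R -> (-1 < v)%R.
  by apply: lt_le_trans; rewrite ltrN10.
pose F (v : R) := (- (a - 1)^-1 * (1 + v) `^ (- (a - 1)))%R.
have dF (v : R) : (-1 < v)%R -> is_derive v 1%R F ((1 + v) `^ (- a))%R.
  move=> v1; rewrite /F; apply: is_derive_eq.
    by apply: is_deriveZ; exact: dP.
  rewrite /GRing.scale/= mulrA mulrNN mulVf ?gt_eqF// mul1r.
  by congr (_ `^ _)%R; ring.
rewrite (@ge0_continuous_FTC2y _ _ F _ 0)//.
- by rewrite /F addr0 powR1 mulr1 sub0e EFinN oppeK.
- by move=> v _; rewrite powR_ge0.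
- apply: derivable_within_continuous => v; rewrite in_itv/= andbT => v0.
  by have [] := dP (- a)%R v (v0N1 _ v0).
- rewrite /F -[X in _ --> X](mulr0 (- (a - 1)^-1)%R); apply: cvgMr.
  exact: cvgy_powRN.
- by move=> v v0; have [] := dF v (v0N1 _ (ltW v0)).
- apply: cvg_at_right_filter; apply/differentiable_continuous.
  by rewrite -derivable1_diffP; have [] := dF _ (v0N1 _ (lexx 0%R)).
- move=> v; rewrite in_itv/= andbT => v0; rewrite derive1E.
  by have [_ ->] := dF v (v0N1 _ (ltW v0)).
Qed.

Section inverse_moment.
Context d (T : measurableType d) (m : {sigma_finite_measure set T -> \bar R}).
Variables (S : T -> R) (a : R).
Hypotheses (mS : measurable_fun setT S) (S0 : forall x, (0 < S x)%R).

Let f (p : T * measurableTypeR R) : \bar R :=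
  ((expR (- (p.2 * S p.1))) * \1_(`[0%R, +oo[ : set R) p.2)%:E.

Let mf : measurable_fun setT f.
Proof.
apply/measurable_EFinP; apply: measurable_funM.
  apply: measurableT_comp => //; apply: measurableT_comp => //.
  apply: measurable_funM => //.
  exact: measurableT_comp.
by apply: measurableT_comp => //.
Qed.

Let f0 p : 0 <= f p.
Proof. by rewrite lee_fin mulr_ge0// expR_ge0. Qed.

(** Tonelli applied to [1 / S], the integral of [exp (- v * S)] over [v >= 0]. *)
Lemma le_integral_inv : (1 < a)%R ->
  (forall v, (0 <= v)%R ->
     \int[m]_x (expR (- (v * S x)))%:E <= ((1 + v) `^ (- a))%:E) ->
  \int[m]_x ((S x)^-1)%:E <= ((a - 1)^-1)%:E.
Proof.
move=> a1 lap.
have -> : \int[m]_x ((S x)^-1)%:E = \int[m]_x \int[mu]_v f (x, v).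
  apply: eq_integral => x _; rewrite -integral_expR_itvy// integral_mkcond.
  apply: eq_integral => v _; rewrite patchE /f /= indicE.
  by case: ifPn => _; rewrite ?mulr1 ?mulr0.
rewrite (fubini_tonelli _ mf f0) -integral_powR_itvy// [leRHS]integral_mkcond.
apply: ge0_le_integral => //.
- by move=> v _; apply: integral_ge0.
- exact: measurable_fun_fubini_tonelli_G.
- apply/(measurable_restrictT _ _).1 => //.
  apply/measurable_EFinP/measurable_funTS.
  apply: (@measurableT_comp _ _ _ _ _ _ (fun x : R => x `^ (- a))%R setT
    (fun v : measurableTypeR R => 1 + v)%R) => //.
  exact: measurable_funD.
move=> v _; rewrite patchE; case: ifPn => v0.
  apply: le_trans (lap v _); last by move: v0; rewrite inE/= in_itv/= andbT.
  rewrite le_eqVlt; apply/orP; left; apply/eqP.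
  by apply: eq_integral => x _; rewrite /f/= indicE v0 mulr1.
by rewrite integral0_eq// => x _; rewrite /f/= indicE (negbTE v0) mulr0.
Qed.
End inverse_moment.

(** Compares first-order terms at [w = 0], where the right side is [1 + a * w + O(w ^ 2)]; an
    explicit [w] replaces the limit. *)
Lemma le_of_expansion (m a : R) : (0 <= a)%R ->
  (forall w, (0 < w < 1)%R -> (1 + w * m <= (1 - w) `^ (- a))%R) -> (m <= a)%R.
Proof.
move=> a0 H; rewrite leNgt; apply/negP => am.
have m0 : (0 < m)%R by exact: le_lt_trans am.
(* Chosen so that the quadratic loss [w ^ 2 * (1 + a) * m] is half of the gain [w * (m - a)]. *)
pose w : R := ((m - a) / (2 * m * (1 + a)))%R.
have ap : (0 < 1 + a)%R by rewrite ltr_pwDl.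
have w0 : (0 < w)%R by rewrite divr_gt0 ?subr_gt0// !mulr_gt0.
have wE : (w * (1 + a) * m * 2 = m - a)%R.
  by rewrite /w; field; rewrite !gt_eqF.
have w2 : (w * (1 + a) < 1)%R.
  by rewrite ltNge; apply/negP => ge1; nra.
have w1 : (w < 1)%R by nra.
have := H w; rewrite w0 w1 => /(_ isT); apply/negP; rewrite -ltNge.
have p1 : (0 < 1 - w)%R by rewrite subr_gt0.
have p2 : (0 < 1 - w * (1 + a))%R by rewrite subr_gt0.
(* From [- ln (1 - w) <= w / (1 - w)] and [exp y <= 1 / (1 - y)]. *)
have : ((1 - w) `^ (- a) <= (1 - w) / (1 - w * (1 + a)))%R.
  rewrite /powR gt_eqF// mulNr -mulrN -lnV ?posrE//.
  apply: (@le_trans _ _ (expR (a * (w / (1 - w))))).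
    rewrite ler_expR ler_wpM2l//.
    rewrite [X in ln X](_ : _ = 1 + w / (1 - w))%R; last by field; rewrite gt_eqF.
    by apply: le_ln1Dx; apply: lt_le_trans (_ : 0 <= _)%R; rewrite ?ltrN10// divr_ge0// ltW.
  rewrite -[leLHS]invrK -expRN -[leRHS]invrK lef_pV2 ?posrE ?expR_gt0 ?invr_gt0 ?divr_gt0//.
  apply: le_trans (expR_ge1Dx _).
  have -> : (((1 - w) / (1 - w * (1 + a)))^-1 = 1 - a * (w / (1 - w)))%R => //.
  by field; rewrite !gt_eqF.
move=> /le_lt_trans; apply.
rewrite ltr_pdivrMr//.
have -> : ((1 + w * m) * (1 - w * (1 + a)) =
    1 - w + w * (m - a) - w * (w * (1 + a) * m * 2) / 2)%R by field.
have : (0 < w * (m - a))%R by rewrite mulr_gt0 ?subr_gt0.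
rewrite wE; lra.
Qed.

(** The inequality [1 + w * S <= exp (w * S)] bounds the mean by the transform at [v = - w]. The
    value [w = 1/2] already makes the mean finite, so that [le_of_expansion] applies to a real
    number. *)
Lemma le_integral_mean d (T : measurableType d)
    (m : {measure set T -> \bar R}) (S : T -> R) (a : R) :
  m setT = 1 -> measurable_fun setT S -> (forall x, (0 < S x)%R) ->
  (0 <= a)%R ->
  (forall v, (-1 < v)%R ->
     \int[m]_x (expR (- (v * S x)))%:E = ((1 + v) `^ (- a))%:E) ->
  \int[m]_x (S x)%:E <= a%:E.
Proof.
move=> m1 mS S0 a0 lap.
have SE0 x : 0 <= (S x)%:E by rewrite lee_fin ltW.
have H w : (0 < w < 1)%R ->
    1 + w%:E * \int[m]_x (S x)%:E <= ((1 - w) `^ (- a))%:E.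
  move=> /andP[w0 w1]; rewrite -lap ?ltrN2//.
  have mS' : measurable_fun setT (EFin \o S) by exact/measurable_EFinP.
  rewrite -ge0_integralZl//; last by rewrite lee_fin ltW.
  rewrite -[X in X + _ <= _](_ : \int[m]_x (cst 1 x) = 1); last first.
    by rewrite integral_cst// m1 mule1.
  rewrite -ge0_integralD//; last 2 first.
  - by move=> x _; rewrite mule_ge0// lee_fin ltW.
  - exact: measurable_funeM.
  apply: ge0_le_integral => //.
  - by move=> x _; rewrite adde_ge0// mule_ge0// lee_fin ltW.
  - by apply: emeasurable_funD => //; exact: measurable_funeM.
  - apply/measurable_EFinP; apply: measurableT_comp => //.
    by apply: measurable_funN; exact: measurable_funM.
  move=> x _; rewrite -EFinM -EFinD lee_fin.
  by rewrite mulNr opprK expR_ge1Dx.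
have Sfin : \int[m]_x (S x)%:E \is a fin_num.
  rewrite ge0_fin_numE; last exact: integral_ge0.
  rewrite ltNge leye_eq; apply/negP => /eqP Soo.
  have := H (2^-1)%R; rewrite invr_gt0 ltr0n invf_lt1// ltr1n => /(_ isT).
  by rewrite Soo gt0_muley ?lte_fin// addey// leye_eq.
rewrite -(fineK Sfin) lee_fin; apply: le_of_expansion => // w w01.
by have := H w w01; rewrite -[in X in X -> _](fineK Sfin) -EFinM -EFinD lee_fin.
Qed.
End moments.

(** * One step of the chain *)

Lemma measurable_invr (R : realType) : measurable_fun setT (fun x : R => x^-1).
Proof.
rewrite (_ : (fun x => x^-1) =
    (fun x : R => if 0 <= x then x `^ (-1) else - ((- x) `^ (-1)))); last first.
  apply/funext => x; case: leP => x0; first by rewrite powR_inv1.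
  by rewrite powR_inv1 ?invrN ?opprK// oppr_ge0 ltW.
apply: measurable_fun_ifT; first exact: measurable_fun_ler.
  exact: measurable_powR.
apply: measurable_funN.
exact: (@measurableT_comp _ _ _ R R R (fun x : R => x `^ (-1)) setT
  (fun x : R => - x) (measurable_powR _) (measurable_funN (@measurable_id _ R setT))).
Qed.

Lemma pos_ge0 (R : realType) (s : R) : 0 <= pos s.
Proof. exact/ltW/pos_gt0. Qed.

Lemma ge0_integral_prodM d1 d2 (T1 : measurableType d1) (T2 : measurableType d2)
    (R : realType) (m1 : {sigma_finite_measure set T1 -> \bar R})
    (m2 : {sigma_finite_measure set T2 -> \bar R}) (f : T1 -> R) (g : T2 -> R) :
  measurable_fun setT f -> measurable_fun setT g ->
  (forall y, 0 <= f y) -> (forall z, 0 <= g z) ->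
  (\int[m1 \x m2]_p (f p.1 * g p.2)%:E =
   \int[m1]_y (f y)%:E * \int[m2]_z (g z)%:E)%E.
Proof.
move=> mf mg f0 g0.
have mfE : measurable_fun setT (EFin \o f) by exact/measurable_EFinP.
have mgE : measurable_fun setT (EFin \o g) by exact/measurable_EFinP.
rewrite fubini_tonelli1//=; last 2 first.
- apply/measurable_EFinP; apply: measurable_funM; exact: measurableT_comp.
- by move=> p; rewrite lee_fin mulr_ge0.
rewrite -ge0_integralZr//; last 2 first.
- by move=> y _; rewrite lee_fin.
- by apply: integral_ge0 => z _; rewrite lee_fin.
apply: eq_integral => y _; rewrite /fubini_F/=.
under eq_integral do rewrite EFinM.
by rewrite ge0_integralZl//; [move=> z _; rewrite lee_fin | rewrite lee_fin].
Qed.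

Section gamma_moments.
Local Open Scope ereal_scope.
Context {R : realType}.

Section one.
Variables (a : R) (nu : probability R R).
Hypothesis nuE : forall A : set R, measurable A -> nu A = gamma_prob a 1 A.

Lemma laplace_pos (v : R) : (-1 < v)%R ->
  \int[nu]_s (expR (- (v * pos s)))%:E = ((1 + v) `^ (- a))%:E.
Proof.
move=> v1; rewrite (integral_pos (f := fun s => (expR (- (v * s)))%:E) nuE)//.
- by apply: gamma_law_laplace => //; exact: probability_setT.
- apply/measurable_EFinP; apply: measurableT_comp => //.
  by apply: measurable_funN; exact: measurable_funM.
Qed.

Lemma mean_pos : (0 <= a)%R -> \int[nu]_s (pos s)%:E <= a%:E.
Proof.
move=> a0; apply: le_integral_mean => //.
- exact: probability_setT.
- exact: measurable_pos.
- exact: pos_gt0.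
- exact: laplace_pos.
Qed.

Lemma mean_pos_inv : (1 < a)%R ->
  \int[nu]_s ((pos s)^-1)%:E <= ((a - 1)^-1)%:E.
Proof.
move=> a1; apply: le_integral_inv => //.
- exact: measurable_pos.
- exact: pos_gt0.
- by move=> v v0; rewrite laplace_pos// (lt_le_trans _ v0)// ltrN10.
Qed.

End one.

Variables (p q : R) (m1 m3 : probability R R).
Hypothesis m1E : forall A : set R, measurable A -> m1 A = gamma_prob p 1 A.
Hypothesis m3E : forall A : set R, measurable A -> m3 A = gamma_prob q 1 A.

(** By independence the Laplace transforms multiply to [(1 + v) ^ (- (p + q))], which is exactly the
    input of [le_integral_inv]. *)
Lemma mean_pos_add_inv : (1 < p + q)%R ->
  \int[m1 \x m3]_g ((pos g.1 + pos g.2)^-1)%:E <= ((p + q - 1)^-1)%:E.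
Proof.
move=> pq1.
pose S (g : R * R) := (pos g.1 + pos g.2)%R.
have mS : measurable_fun setT S.
  by apply: measurable_funD; apply: measurableT_comp => //; exact: measurable_pos.
have S0 g : (0 < S g)%R by rewrite addr_gt0// pos_gt0.
refine (@le_integral_inv R _ _ ((m1 \x m3)%E : probability (R * R)%type R)
  S (p + q) mS S0 pq1 _).
move=> v v0; have v1 : (-1 < v)%R by rewrite (lt_le_trans _ v0)// ltrN10.
rewrite /S; under eq_integral do rewrite mulrDr opprD expRD.
have me : measurable_fun setT (fun s : R => expR (- (v * pos s)))%R.
  apply: measurableT_comp => //; apply: measurable_funN.
  by apply: measurable_funM => //; exact: measurable_pos.
rewrite (@ge0_integral_prodM _ _ _ _ R m1 m3 (fun s => expR (- (v * pos s)))
  (fun s => expR (- (v * pos s))))//.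
rewrite (laplace_pos m1E)// (laplace_pos m3E)// -EFinM -powRD ?opprD//.
by apply/implyP => _; rewrite gt_eqF// addrC -ltrBlDr sub0r.
Qed.

End gamma_moments.

Section step.
Context {R : realType}.
Variables (x b : R).

Definition rate (u : R) (g : R * R) : R := pos g.1 / (u + x) + pos g.2 / (u + b).

(** The noise is ordered as [((gamma_1, gamma_3), gamma_2)]: Fubini can freeze the denominator and
    leave [gamma_2] free for rescaling. *)
Definition step (u : R) (g : R * R * R) : R := pos g.2 / rate u g.1.

Hypotheses (x0 : 0 < x) (b0 : 0 < b).

Lemma rate_gt0 u g : 0 < u -> 0 < rate u g.
Proof.
by move=> u0; rewrite addr_gt0// divr_gt0 ?pos_gt0// addr_gt0.
Qed.

Lemma step_gt0 u g : 0 < u -> 0 < step u g.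
Proof. by move=> u0; rewrite divr_gt0 ?pos_gt0 ?rate_gt0. Qed.

Lemma measurable_step : measurable_fun setT (fun z : R * (R * R * R) => step z.1 z.2).
Proof.
have mp (h : R * (R * R * R) -> R) : measurable_fun setT h ->
    measurable_fun setT (fun z => pos (h z)).
  by move=> mh; apply: measurableT_comp => //; exact: measurable_pos.
have mi (h : R * (R * R * R) -> R) : measurable_fun setT h ->
    measurable_fun setT (fun z => (h z)^-1).
  by move=> mh; apply: measurableT_comp => //; exact: measurable_invr.
have m2 : measurable_fun setT (fun z : R * (R * R * R) => z.2).
  exact: measurable_snd.
have m21 : measurable_fun setT (fun z : R * (R * R * R) => z.2.1).
  exact: measurableT_comp m2.
have mR (y : R) : measurable_fun setT (fun z : R * (R * R * R) => (z.1 + y)^-1).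
  by apply: mi; apply: measurable_funD.
apply: measurable_funM.
  by apply: mp; exact: measurableT_comp m2.
apply: mi; apply: measurable_funD; apply: measurable_funM => //.
  by apply: mp; exact: measurableT_comp m21.
by apply: mp; exact: measurableT_comp m21.
Qed.

Lemma measurable_step_fix u : measurable_fun setT (step u).
Proof.
exact: (measurableT_comp measurable_step (pair1_measurable u)).
Qed.

Lemma rate_le u g : 0 < u -> rate u g <= pos g.1 / x + pos g.2 / b.
Proof.
move=> u0; have := pos_gt0 g.1; have := pos_gt0 g.2 => p2 p1.
by apply: lerD; rewrite ler_pM2l// lef_pV2 ?posrE ?addr_gt0// lerDr ltW.
Qed.

(** Both [u + x] and [u + b] lie below [u + x + b]; this leaves the inverse of a sum of Gamma
    variables, whose mean is known. *)
Lemma rate_inv_le u g : 0 < u ->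
  (rate u g)^-1 <= (u + x + b) * (pos g.1 + pos g.2)^-1.
Proof.
move=> u0; have := pos_gt0 g.1; have := pos_gt0 g.2 => p2 p1.
have s0 : 0 < u + x + b by rewrite !addr_gt0.
have P0 : 0 < pos g.1 + pos g.2 by rewrite addr_gt0.
rewrite -[leRHS]invrK lef_pV2 ?posrE ?rate_gt0 ?invr_gt0 ?divr_gt0//.
rewrite invf_div mulrDl; apply: lerD; rewrite ler_pM2l// lef_pV2 ?posrE ?addr_gt0//.
- by rewrite lerDl ltW.
- by rewrite addrAC lerDl ltW.
Qed.

(** For [y] equal to [x] or [b], the weight changes by [(w + y) / (u + y)], which is largest at the
    smaller [y]. *)
Lemma rate_ratio_le u w g : 0 < u -> u <= w ->
  rate w g <= rate u g <= rate w g * ((w + Num.min x b) / (u + Num.min x b)).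
Proof.
move=> u0 uw; have w0 := lt_le_trans u0 uw.
have := pos_gt0 g.1; have := pos_gt0 g.2 => p2 p1.
have m0 : 0 < Num.min x b by rewrite lt_min x0.
apply/andP; split.
  by apply: lerD; rewrite ler_pM2l// lef_pV2 ?posrE ?addr_gt0// lerD2r.
have H y : Num.min x b <= y ->
    (u + y)^-1 <= (w + y)^-1 * ((w + Num.min x b) / (u + Num.min x b)).
  move=> my; have y0 : 0 < y by exact: lt_le_trans my.
  rewrite -[leLHS]mul1r ler_pdivrMr ?addr_gt0//.
  rewrite (_ : _ * (u + y) = ((w + Num.min x b) * (u + y)) /
     ((w + y) * (u + Num.min x b))); last first.
    by field; rewrite !gt_eqF ?addr_gt0.
  rewrite ler_pdivlMr ?mulr_gt0 ?addr_gt0// mul1r.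
  rewrite -subr_ge0 (_ : _ - _ = (w - u) * (y - Num.min x b)); last by ring.
  by rewrite mulr_ge0// subr_ge0.
rewrite mulrDl; apply: lerD; rewrite -mulrA ler_pM2l// H// ge_min lexx ?orbT//.
Qed.

End step.

Section drift.
Local Open Scope ereal_scope.
Context {R : realType}.
Variables (x b p s q : R) (m1 m2 m3 : probability R R).
Hypotheses (x0 : (0 < x)%R) (b0 : (0 < b)%R) (p0 : (0 <= p)%R) (q0 : (0 <= q)%R)
  (s1 : (1 < s)%R) (pq1 : (1 < p + q)%R).
Hypothesis m1E : forall A : set R, measurable A -> m1 A = gamma_prob p 1 A.
Hypothesis m2E : forall A : set R, measurable A -> m2 A = gamma_prob s 1 A.
Hypothesis m3E : forall A : set R, measurable A -> m3 A = gamma_prob q 1 A.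

Let m13 : probability (R * R)%type R := (m1 \x m3).

Definition noise_prob : probability (R * R * R)%type R := (m13 \x m2).

Local Notation nu := noise_prob.

(** As [gamma_2] is independent of the rate, each term is bounded by a product of two moments: the
    mean of [gamma_2] with an inverse moment of [gamma_1 + gamma_3], and the inverse moment of
    [gamma_2] with a mean linear in [gamma_1] and [gamma_3]. *)
Lemma mean_step_le (u : R) : (0 < u)%R ->
  \int[nu]_g (step x b u g + (step x b u g)^-1)%:E <=
  (s * (u + x + b) / (p + q - 1) + (p / x + q / b) / (s - 1))%:E.
Proof.
move=> u0.
have u3 : (0 < u + x + b)%R by rewrite !addr_gt0.
have mpos : measurable_fun setT (@pos R) by exact: measurable_pos.
have mpi : measurable_fun setT (fun t : R => (pos t)^-1)%R.
  by apply: measurableT_comp => //; exact: measurable_invr.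
have mp1 : measurable_fun setT (fun g : R * R => pos g.1) by exact: measurableT_comp.
have mp2 : measurable_fun setT (fun g : R * R => pos g.2) by exact: measurableT_comp.
pose F (g : R * R) := ((u + x + b) * (pos g.1 + pos g.2)^-1)%R.
pose G (g : R * R) := (pos g.1 / x + pos g.2 / b)%R.
have F0 g : (0 <= F g)%R.
  by rewrite mulr_ge0 ?(ltW u3)// invr_ge0 addr_ge0// pos_ge0.
have G0 g : (0 <= G g)%R.
  by rewrite addr_ge0// divr_ge0 ?pos_ge0// ltW.
have mF : measurable_fun setT F.
  apply: measurable_funM => //; apply: measurableT_comp; first exact: measurable_invr.
  exact: measurable_funD.
have mG : measurable_fun setT G.
  by apply: measurable_funD; apply: measurable_funM.
have mF2 : measurable_fun setT (fun g : R * R * R => (F g.1 * pos g.2)%:E).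
  by apply/measurable_EFinP; apply: measurable_funM; apply: measurableT_comp.
have mG2 : measurable_fun setT (fun g : R * R * R => (G g.1 * (pos g.2)^-1)%:E).
  by apply/measurable_EFinP; apply: measurable_funM;
    [exact: measurableT_comp|exact: (measurableT_comp mpi)].
have ms := measurable_step_fix x b u.
apply: (@le_trans _ _ (\int[nu]_g ((F g.1 * pos g.2)%:E + (G g.1 * (pos g.2)^-1)%:E))).
  apply: ge0_le_integral => //.
  - by move=> g _; rewrite lee_fin addr_ge0 ?invr_ge0// ltW// step_gt0.
  - apply/measurable_EFinP; apply: measurable_funD => //.
    by apply: measurableT_comp => //; exact: measurable_invr.
  - exact: emeasurable_funD.
  move=> g _; rewrite -EFinD lee_fin; apply: lerD.
    by rewrite /step mulrC ler_wpM2r ?(ltW (pos_gt0 _))// rate_inv_le.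
  by rewrite /step invf_div ler_wpM2r ?invr_ge0 ?(ltW (pos_gt0 _))// rate_le.
rewrite ge0_integralD//; last 2 first.
- by move=> g _; rewrite lee_fin mulr_ge0// ltW// pos_gt0.
- by move=> g _; rewrite lee_fin mulr_ge0// invr_ge0 ltW// pos_gt0.
rewrite EFinD; apply: leeD.
  rewrite (@ge0_integral_prodM _ _ _ _ R m13 m2 F (@pos R))//; last first.
    by move=> t; exact: pos_ge0.
  rewrite (_ : (s * (u + x + b) / (p + q - 1))%:E =
     ((u + x + b)%:E * ((p + q - 1)^-1)%:E) * s%:E); last first.
    by rewrite -!EFinM; congr (_%:E); ring.
  apply: lee_pmul.
  - by apply: integral_ge0 => g _; rewrite lee_fin.
  - by apply: integral_ge0 => g _; rewrite lee_fin pos_ge0.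
  - under eq_integral do rewrite EFinM.
    rewrite ge0_integralZl//; last 3 first.
    + apply/measurable_EFinP; apply: measurableT_comp; first exact: measurable_invr.
      exact: measurable_funD.
    + by move=> g _; rewrite lee_fin invr_ge0 addr_ge0// pos_ge0.
    + by rewrite lee_fin ltW.
    by apply: lee_wpmul2l; [rewrite lee_fin ltW|exact: mean_pos_add_inv].
  - by apply: mean_pos => //; rewrite (le_trans _ (ltW s1)).
rewrite (@ge0_integral_prodM _ _ _ _ R m13 m2 G (fun t => (pos t)^-1)%R)//; last first.
  by move=> t; rewrite invr_ge0 pos_ge0.
rewrite EFinM; apply: lee_pmul.
- by apply: integral_ge0 => g _; rewrite lee_fin.
- by apply: integral_ge0 => g _; rewrite lee_fin invr_ge0 pos_ge0.
- have mean1 (m : probability R R) (y a : R) : (0 < y)%R ->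
      \int[m]_t (pos t)%:E <= a%:E -> \int[m]_t (pos t / y)%:E <= (a / y)%:E.
    move=> y0 ma; under eq_integral do rewrite EFinM.
    rewrite ge0_integralZr//; last 3 first.
    + exact/measurable_EFinP.
    + by move=> t _; rewrite lee_fin pos_ge0.
    + by rewrite lee_fin invr_ge0 ltW.
    by rewrite EFinM lee_wpmul2r// lee_fin invr_ge0 ltW.
  have i1 (m : probability R R) : \int[m]_z (cst 1%R z)%:E = 1.
    transitivity (\int[m]_z (cst 1%:E z)) => //.
    by rewrite integral_cst// mul1e; exact: probability_setT.
  under eq_integral do rewrite EFinD.
  rewrite ge0_integralD//; last 4 first.
  + by move=> g _; rewrite lee_fin divr_ge0 ?pos_ge0// ltW.
  + by apply/measurable_EFinP; exact: measurable_funM.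
  + by move=> g _; rewrite lee_fin divr_ge0 ?pos_ge0// ltW.
  + by apply/measurable_EFinP; exact: measurable_funM.
  rewrite EFinD; apply: leeD.
    under eq_integral do rewrite -[X in X%:E]mulr1.
    rewrite (@ge0_integral_prodM _ _ _ _ R m1 m3 (fun t => pos t / x)%R (cst 1%R))//;
      [|exact: measurable_funM|by move=> t; rewrite divr_ge0 ?pos_ge0// ltW].
    rewrite i1 mule1.
    by apply: mean1 => //; exact: mean_pos.
  under eq_integral do rewrite -[X in X%:E]mul1r.
  rewrite (@ge0_integral_prodM _ _ _ _ R m1 m3 (cst 1%R) (fun t => pos t / b)%R)//;
      [|exact: measurable_funM|by move=> t; rewrite divr_ge0 ?pos_ge0// ltW].
  rewrite i1 mul1e.
  by apply: mean1 => //; exact: mean_pos.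
- exact: mean_pos_inv.
Qed.

(** The integral of [h] is at most 1, so the factor [k ^ (- s)] costs at most
    [1 - k ^ (- s) <= s * ln k <= s * (k - 1)]. *)
Lemma oneshot_fiber (k : R) (h : R -> \bar R) : (1 <= k)%R ->
  measurable_fun setT h -> (forall t, 0 <= h t <= 1) ->
  \int[m2]_z h (pos z) <= \int[m2]_z h (k * pos z)%R + (s * (k - 1))%:E.
Proof.
move=> k1 mh h01.
have h0 t : 0 <= h t by have /andP[] := h01 t.
have mhk : measurable_fun setT (fun t => h (k * t)%R).
  by apply: measurableT_comp => //; exact: measurable_funM.
rewrite (integral_pos m2E)// (integral_pos (f := fun t => h (k * t)%R) m2E)//.
have I1 : \int[m2]_t h t <= 1.
  apply: (@le_trans _ _ (\int[m2]_t 1)); last first.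
    by rewrite integral_cst// mul1e probability_le1.
  by apply: ge0_le_integral => // t _; have /andP[] := h01 t.
have Ifin : \int[m2]_t h t \is a fin_num.
  by rewrite ge0_fin_numE ?integral_ge0// (le_lt_trans I1)// ltry.
have k0 : (0 < k)%R by exact: lt_le_trans k1.
have ks : (1 - s * (k - 1) <= k `^ (- s))%R.
  rewrite /powR gt_eqF//; apply: le_trans (expR_ge1Dx _).
  rewrite lerD2l mulNr lerN2 ler_wpM2l ?(le_trans _ (ltW s1))//.
  by rewrite -[X in (ln X <= _)%R](subrK 1%R) addrC le_ln1Dx// ltrBrDr addrC subrr.
have := gamma_law_dilate m2E k1 mh h0.
rewrite -(fineK Ifin) -EFinM => /(leeD2r (s * (k - 1))%:E); apply: le_trans.
have i1 : (fine (\int[m2]_t h t) <= 1)%R by rewrite -lee_fin fineK.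
have i0 : (0 <= fine (\int[m2]_t h t))%R by rewrite fine_ge0// integral_ge0.
rewrite -EFinD lee_fin; set I := fine _ in i1 i0 *.
have sk : (0 <= s * (k - 1))%R by rewrite mulr_ge0 ?subr_ge0// (le_trans _ (ltW s1)).
nra.
Qed.

(** With [gamma_1] and [gamma_3] frozen, the step from [w] is the step from [u] with [gamma_2]
    multiplied by the ratio [k] of the two rates, and [k - 1 <= (w - u) / (u + Num.min x b)]. *)
Lemma oneshot (u w : R) (f : R -> \bar R) : (0 < u)%R -> (u <= w)%R ->
  measurable_fun setT f -> (forall t, 0 <= f t <= 1) ->
  \int[nu]_g f (step x b u g) <=
  \int[nu]_g f (step x b w g) +
    (s * ((w - u) / (u + Num.min x b)))%:E.
Proof.
move=> u0 uw mf f01.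
have f0 t : 0 <= f t by have /andP[] := f01 t.
have w0 := lt_le_trans u0 uw.
have m0 : (0 < Num.min x b)%R by rewrite lt_min x0.
set c := (s * _)%R.
have c0 : (0 <= c)%R.
  by rewrite mulr_ge0 ?(le_trans _ (ltW s1))// divr_ge0 ?subr_ge0// ltW// addr_gt0.
have mfs (v : R) : measurable_fun setT (fun g => f (step x b v g)).
  by apply: measurableT_comp => //; exact: measurable_step_fix.
rewrite !(fubini_tonelli1 (fun g => f (step x b _ g)))//.
have -> : c%:E = \int[m13]_g (cst c%:E g).
  by rewrite integral_cst// -[LHS]mule1; congr (_ * _); exact/esym/probability_setT.
have mF v : measurable_fun setT
    (fubini_F m2 (fun g : (R * R) * R => f (step x b v g))).
  exact: measurable_fun_fubini_tonelli_F.
rewrite -ge0_integralD//; last by move=> g _; apply: integral_ge0.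
apply: ge0_le_integral => //.
- by move=> g _; apply: integral_ge0.
- by apply: emeasurable_funD.
move=> g _; rewrite /fubini_F/= /step/=.
have ru := rate_gt0 x0 b0 g u0; have rw := rate_gt0 x0 b0 g w0.
have /andP[r1 r2] := rate_ratio_le x0 b0 g u0 uw.
pose k := (rate x b u g / rate x b w g)%R.
have k1 : (1 <= k)%R by rewrite ler_pdivlMr// mul1r.
apply: le_trans (oneshot_fiber (h := fun t => f (t / rate x b u g)%R) k1 _ _) _ => //.
  by apply: measurableT_comp => //; exact: measurable_funM.
apply: leeD.
  rewrite le_eqVlt; apply/orP; left; apply/eqP; apply: eq_integral => z _.
  by congr f; rewrite /k; field; rewrite !gt_eqF.
rewrite lee_fin /c ler_wpM2l ?(le_trans _ (ltW s1))//.
rewrite lerBlDr ler_pdivrMr// mulrC (le_trans r2)// ler_wpM2l ?(ltW rw)//.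
rewrite le_eqVlt; apply/orP; left; apply/eqP; field.
by rewrite gt_eqF// addr_gt0.
Qed.

End drift.

(** * The law of the chain *)

Section mfun_of.
Context d1 d2 (T1 : measurableType d1) (T2 : measurableType d2).
Variables (f : T1 -> T2) (mf : measurable_fun setT f).

Let f_mixin := isMeasurableFun.Build _ _ _ _ f mf.

Definition mfun_of : {mfun T1 >-> T2} := HB.pack f f_mixin.

End mfun_of.

Section pair_law.
Local Open Scope ereal_scope.
Context d d1 d2 (T : measurableType d) (T1 : measurableType d1)
  (T2 : measurableType d2) (R : realType) (P : probability T R).
Variables (Y : T -> T1) (X : T -> T2).
Hypotheses (mY : measurable_fun setT Y) (mX : measurable_fun setT X).

Let mYX : measurable_fun setT (fun w => (Y w, X w)).
Proof. exact: measurable_fun_pair. Qed.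

Lemma pair_law (m1 : probability T1 R) (m2 : probability T2 R) :
  (forall A, measurable A -> P (Y @^-1` A) = m1 A) ->
  (forall B, measurable B -> P (X @^-1` B) = m2 B) ->
  (forall A B, measurable A -> measurable B ->
    P (Y @^-1` A `&` X @^-1` B) = P (Y @^-1` A) * P (X @^-1` B)) ->
  forall C, measurable C -> P ((fun w => (Y w, X w)) @^-1` C) = (m1 \x m2) C.
Proof.
move=> Ym1 Xm2 YX C mC.
rewrite (@product_measure_unique _ _ _ _ _ m1 m2
  (distribution P (mfun_of mYX)))// => A B mA mB.
transitivity (P (Y @^-1` A `&` X @^-1` B)) => //.
by rewrite YX//; congr (_ * _); [exact: Ym1|exact: Xm2].
Qed.

Variable E : set T.
Hypothesis mE : measurable E.

(** Both sides are finite measures in [C]. On rectangles they agree with the product of [P E] times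
    the law of [Y] and the law of [X], hence they agree everywhere. *)
Lemma indep_pair :
  (forall A B, measurable A -> measurable B ->
    P (Y @^-1` A `&` X @^-1` B) = P (Y @^-1` A) * P (X @^-1` B)) ->
  (forall A B, measurable A -> measurable B ->
    P (Y @^-1` A `&` X @^-1` B `&` E) = P (Y @^-1` A) * P (X @^-1` B) * P E) ->
  forall C, measurable C ->
    P ((fun w => (Y w, X w)) @^-1` C `&` E) =
    P ((fun w => (Y w, X w)) @^-1` C) * P E.
Proof.
move=> YX YXE C mC.
have PE0 : (0 <= fine (P E))%R by rewrite fine_ge0.
have PEfin : P E \is a fin_num by exact: fin_num_measure.
pose k := NngNum PE0.
pose m1 : {finite_measure set T1 -> \bar R} := mscale k (distribution P (mfun_of mY)).
pose mL : {measure set (T1 * T2) -> \bar R} :=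
  @measure_function_pushforward__canonical__measure_function_Measure
    _ _ _ _ _ (mrestr P mE) (fun w => (Y w, X w)) mYX.
pose mR : {measure set (T1 * T2) -> \bar R} :=
  mscale k (distribution P (mfun_of mYX)).
transitivity ((m1 \x distribution P (mfun_of mX)) C).
  rewrite (@product_measure_unique _ _ _ _ _ m1 (distribution P (mfun_of mX)) mL)//.
  move=> A B mA mB; rewrite /mL /=.
  rewrite -[LHS]/(P (Y @^-1` A `&` X @^-1` B `&` E)) YXE//.
  rewrite /m1 /mscale/= fineK// -[RHS]muleA muleC; congr (_ * _).
rewrite (@product_measure_unique _ _ _ _ _ m1 (distribution P (mfun_of mX)) mR)//.
  by rewrite -[LHS]/(k%:num%:E * P ((fun w => (Y w, X w)) @^-1` C)) /= fineK// muleC.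
move=> A B mA mB.
rewrite -[RHS]/(k%:num%:E * P (Y @^-1` A) * P (X @^-1` B)) -[RHS]muleA.
congr (_ * _); exact: YX.
Qed.

End pair_law.

Section markov.
Local Open Scope ereal_scope.
Context d (T : measurableType d) (R : realType) (P : probability T R).
Variables (x b p s q u0 : R) (gam : nat -> nat -> {RV P >-> R}).
Variables (m1 m2 m3 : probability R R).
Hypotheses (x0 : (0 < x)%R) (b0 : (0 < b)%R) (u00 : (0 < u0)%R).
Hypothesis m1E : forall A : set R, measurable A -> m1 A = gamma_prob p 1 A.
Hypothesis m2E : forall A : set R, measurable A -> m2 A = gamma_prob s 1 A.
Hypothesis m3E : forall A : set R, measurable A -> m3 A = gamma_prob q 1 A.
Let D := [set i : nat * nat | (1 <= i.1)%N /\ (1 <= i.2 <= 3)%N].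
Let X (i : nat * nat) := gam i.1 i.2.
Hypothesis indX : mutually_independent D X.
Hypothesis law1 : forall t, (1 <= t)%N -> has_gamma_law (gam t 1%N) p 1.
Hypothesis law2 : forall t, (1 <= t)%N -> has_gamma_law (gam t 2%N) s 1.
Hypothesis law3 : forall t, (1 <= t)%N -> has_gamma_law (gam t 3%N) q 1.

(* [cyl S] is a pi-system of cylinder events with indices in [S]; independence
   of noise and chain is first proved on it and then extended to products. *)
Let cyl (S : set (nat * nat)) (E : set T) :=
  exists (F : {fset nat * nat}) (B : nat * nat -> set R),
    [/\ [set` F] `<=` D `&` S, forall i, measurable (B i) &
        E = \bigcap_(i in [set` F]) X i @^-1` B i].

Let cyl_meas S E : cyl S E -> measurable E.
Proof.
move=> [F [B [_ mB ->]]]; apply: fin_bigcap_measurable => // i _.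
exact: measurable_sfunP.
Qed.

Let cyl_sub S S' E : S `<=` S' -> cyl S E -> cyl S' E.
Proof.
move=> SS' [F [B [FS mB ->]]]; exists F, B; split => //.
by move=> i /FS[Di Si]; split => //; exact: SS'.
Qed.

Let cylT S : cyl S setT.
Proof.
exists fset0, (fun _ => setT); split => //.
by rewrite set_fset0 bigcap_set0.
Qed.

Let cyl_cons S E j B0 : D j -> ~ S j -> cyl S E -> measurable B0 ->
  cyl (S `|` [set j]) (X j @^-1` B0 `&` E) /\
  P (X j @^-1` B0 `&` E) = P (X j @^-1` B0) * P E.
Proof.
move=> Dj Sj [F [B [FS mB ->]]] mB0.
have jF : j \notin F by apply/negP => /FS[].
pose B' i := if i == j then B0 else B i.
have mB' i : measurable (B' i) by rewrite /B'; case: ifPn.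
have B'F i : i \in F -> B' i = B i.
  by rewrite /B'; case: eqP => // -> jF'; rewrite jF' in jF.
have EE : X j @^-1` B0 `&` \bigcap_(i in [set` F]) X i @^-1` B i =
    \bigcap_(i in [set` j |` F]%fset) X i @^-1` B' i.
  rewrite set_fsetU set_fset1 bigcap_setU bigcap_set1 {1}/B' eqxx.
  by congr (_ `&` _); apply: eq_bigcapr => i iF; rewrite B'F.
have FD : [set` (j |` F)%fset] `<=` D.
  by rewrite set_fsetU set_fset1 => i [->//|/FS[]].
split.
  exists (j |` F)%fset, B'; split => //.
  rewrite set_fsetU set_fset1 => i [->|/FS[Di Si]]; split => //; [by right|by left].
rewrite EE indX// big_fsetU1//= {1}/B' eqxx; congr (_ * _).
rewrite indX//; last by move=> i /FS[].
by rewrite [RHS]big_seq [LHS]big_seq; apply: eq_bigr => i iF; rewrite B'F.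
Qed.

Let G (t : nat) (w : T) : R * R * R := (gam t 1 w, gam t 3 w, gam t 2 w).

Let mG t : measurable_fun setT (G t).
Proof. by do 2 apply: measurable_fun_pair => //. Qed.

Let future (t : nat) := [set i : nat * nat | (t < i.1)%N].

(** A version of the chain that stays positive at every point; any solution of the recursion agrees
    with it almost surely. *)
Fixpoint chain (t : nat) : T -> R :=
  if t is t'.+1 then fun w => step x b (chain t' w) (G t'.+1 w) else cst u0.

Lemma measurable_chain t : measurable_fun setT (chain t).
Proof.
elim: t => [|t IH] //=.
apply: (measurableT_comp (measurable_step x b)
  (measurable_fun_pair IH (mG t.+1))).
Qed.

Let measurable_pre d1 (T1 : measurableType d1) (Y : T -> T1) A :
  measurable_fun setT Y -> measurable A -> measurable (Y @^-1` A).
Proof. by move=> mY mA; rewrite -[X in measurable X]setTI; exact: mY. Qed.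

(** The invariant behind the Markov property. The future starts strictly after [t], so one step may
    consume the noise of time [t.+1]. *)
Let Ind (t : nat) := forall A E, measurable A -> cyl (future t) E ->
  P (chain t @^-1` A `&` E) = P (chain t @^-1` A) * P E.

Let rect t : Ind t -> forall A B1 B3 B2 E, measurable A -> measurable B1 ->
  measurable B3 -> measurable B2 -> cyl (future t.+1) E ->
  P (chain t @^-1` A `&` (gam t.+1 1 @^-1` B1 `&` (gam t.+1 3 @^-1` B3 `&`
    (gam t.+1 2 @^-1` B2 `&` E)))) =
  P (chain t @^-1` A) * (P (gam t.+1 1 @^-1` B1) * (P (gam t.+1 3 @^-1` B3) *
    (P (gam t.+1 2 @^-1` B2) * P E))).
Proof.
move=> It A B1 B3 B2 E mA mB1 mB3 mB2 cE.
have DX k : (1 <= k <= 3)%N -> D (t.+1, k) by move=> k3; split.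
have nf k : ~ future t.+1 (t.+1, k) by rewrite /future/= ltnn.
have [c2 P2] := cyl_cons (DX 2%N isT) (nf 2%N) cE mB2.
have [|c3 P3] := cyl_cons (DX 3%N isT) _ c2 mB3; first by case=> [/nf|].
have [|c1 P1] := cyl_cons (DX 1%N isT) _ c3 mB1; first by case=> [[/nf|]|].
rewrite -P2 -P3 -P1 It//.
by apply: cyl_sub c1 => -[i k] [[[]|]|]/= => [/ltnW//|[->]|[->]|[->]]; rewrite /future/=.
Qed.

Let pre_setT d1 (T1 : measurableType d1) (Y : T -> T1) : P (Y @^-1` setT) = 1.
Proof. by rewrite preimage_setT probability_setT. Qed.

Let measurable_gam t k B : measurable B -> measurable (gam t k @^-1` B).
Proof. by move=> mB; exact: measurable_pre. Qed.

(** [rect] gives independence on boxes only. Each use of [indep_pair] glues two coordinates: here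
    [gamma_1] with [gamma_3], next this pair with [gamma_2], finally the state with the noise. *)
Let pair_indep t : Ind t -> forall A B E C, measurable A -> measurable B ->
  cyl (future t.+1) E -> measurable C ->
  P ((fun w => (gam t.+1 1 w, gam t.+1 3 w)) @^-1` C `&`
      (gam t.+1 2 @^-1` B `&` (chain t @^-1` A `&` E))) =
  P ((fun w => (gam t.+1 1 w, gam t.+1 3 w)) @^-1` C) *
  (P (gam t.+1 2 @^-1` B) * (P (chain t @^-1` A) * P E)).
Proof.
move=> It A B E C mA mB cE mC.
have mE := cyl_meas cE.
have mcA := measurable_pre (measurable_chain t) mA.
have PE : P (gam t.+1 2 @^-1` B `&` (chain t @^-1` A `&` E)) =
    P (gam t.+1 2 @^-1` B) * (P (chain t @^-1` A) * P E).
  have := rect It mA measurableT measurableT mB cE.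
  rewrite !pre_setT !mul1e !preimage_setT !setTI setICA => ->.
  by rewrite muleCA.
rewrite -PE; apply: indep_pair => //.
- by apply: measurableI; [exact: measurable_gam|exact: measurableI].
- move=> B1 B3 mB1 mB3.
  have := rect It measurableT mB1 mB3 measurableT (cylT _).
  by rewrite !pre_setT !preimage_setT ?probability_setT !mul1e !mule1 setTI !setIT.
- move=> B1 B3 mB1 mB3; rewrite PE.
  rewrite (_ : _ `&` _ = chain t @^-1` A `&` (gam t.+1 1 @^-1` B1 `&`
    (gam t.+1 3 @^-1` B3 `&` (gam t.+1 2 @^-1` B `&` E)))); last first.
    by apply/seteqP; split => w /=; tauto.
  rewrite rect// muleCA -[RHS]muleA; congr (_ * _).
  by rewrite muleCA; congr (_ * _); rewrite muleCA.
Qed.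

Let noise_indep t : Ind t -> forall A E C, measurable A ->
  cyl (future t.+1) E -> measurable C ->
  P (G t.+1 @^-1` C `&` (chain t @^-1` A `&` E)) =
  P (G t.+1 @^-1` C) * (P (chain t @^-1` A) * P E).
Proof.
move=> It A E C mA cE mC.
have mE := cyl_meas cE.
have mcA := measurable_pre (measurable_chain t) mA.
have mg13 : measurable_fun setT (fun w => (gam t.+1 1 w, gam t.+1 3 w)).
  exact: measurable_fun_pair.
have cT := cylT (future t.+1).
have cE' : cyl (future t) E by apply: cyl_sub cE => i; exact: ltnW.
rewrite -(It _ _ mA cE').
apply: (indep_pair mg13) => //; first exact: measurableI.
- move=> C' B mC' mB.
  have := pair_indep It measurableT mB cT mC'.
  by rewrite !pre_setT ?probability_setT !mule1 preimage_setT !setIT.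
- move=> C' B mC' mB.
  have := pair_indep It mA mB cE mC'.
  by rewrite setIA It// muleA.
Qed.

Let Ind_chain t : Ind t.
Proof.
elim: t => [|t IH] A E mA cE.
  rewrite /= preimage_cst; case: ifPn => _.
    by rewrite setTI probability_setT mul1e.
  by rewrite set0I measure0 mul0e.
pose YG w := (chain t w, G t.+1 w).
have -> : chain t.+1 @^-1` A = YG @^-1` ((fun z => step x b z.1 z.2) @^-1` A) by [].
have mC : measurable ((fun z => step x b z.1 z.2) @^-1` A).
  by rewrite -[X in measurable X]setTI; exact: measurable_step.
move: mC; move: (_ @^-1` A) => C mC.
apply: (indep_pair (measurable_chain t) (mG t.+1) (cyl_meas cE)) => //.
  move=> B1 B2 mB1 mB2; rewrite setIC -[chain t @^-1` _]setIT.
  by rewrite (noise_indep IH)// probability_setT mule1 muleC setIT.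
move=> B1 B2 mB1 mB2; rewrite [X in P (X `&` _)]setIC -setIA.
by rewrite (noise_indep IH)// [X in _ = X * _]muleC muleA.
Qed.

Let noise_law t : forall C, measurable C ->
  P (G t.+1 @^-1` C) = noise_prob m1 m2 m3 C.
Proof.
have It := @Ind_chain t.
have cT := cylT (future t.+1).
have mg13 : measurable_fun setT (fun w => (gam t.+1 1 w, gam t.+1 3 w)).
  exact: measurable_fun_pair.
apply: (pair_law mg13) => //.
- apply: pair_law => //.
  + by move=> B mB; rewrite m1E//; exact: law1.
  + by move=> B mB; rewrite m3E//; exact: law3.
  + move=> B1 B3 mB1 mB3.
    have := rect It measurableT mB1 mB3 measurableT cT.
    by rewrite !pre_setT !preimage_setT ?probability_setT !mul1e !mule1 setTI !setIT.
- by move=> B mB; rewrite m2E//; exact: law2.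
move=> C' B mC' mB.
have := pair_indep It measurableT mB cT mC'.
by rewrite !pre_setT ?probability_setT !mule1 preimage_setT !setIT.
Qed.

Lemma mean_chain t (f : R -> \bar R) : measurable_fun setT f ->
  (forall y, 0 <= f y) ->
  \int[P]_w f (chain t w) =
  iter t (fun h y => \int[noise_prob m1 m2 m3]_g h (step x b y g)) f u0.
Proof.
elim: t f => [|t IH] f mf f0.
  rewrite /= integral_cst//= -[RHS]mule1; congr (_ * _); exact: probability_setT.
pose Kf y := \int[noise_prob m1 m2 m3]_g f (step x b y g).
(* The innermost application is peeled off: averaging over the last step replaces [f] by [Kf], and
   the induction hypothesis is used at [Kf]. *)
rewrite iterSr -/Kf.
have mfs : measurable_fun setT (fun z : R * (R * R * R) => f (step x b z.1 z.2)).
  by apply: measurableT_comp => //; exact: measurable_step.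
have mKf : measurable_fun setT Kf.
  exact: (@measurable_fun_fubini_tonelli_F _ _ R (R * R * R)%type R
    (noise_prob m1 m2 m3) _ mfs (fun z => f0 _)).
rewrite -IH//; last by move=> y; exact: integral_ge0.
have mYG : measurable_fun setT (fun w => (chain t w, G t.+1 w)).
  by apply: measurable_fun_pair => //; exact: measurable_chain.
transitivity (\int[distribution P (mfun_of mYG)]_z f (step x b z.1 z.2)).
  by rewrite ge0_integral_distribution.
rewrite (eq_measure_integral
   (distribution P (mfun_of (measurable_chain t)) \x noise_prob m1 m2 m3)); last first.
  move=> C mC _; apply: (pair_law (measurable_chain t) (mG t.+1)) => //.
    exact: noise_law.
  move=> A B mA mB; rewrite setIC -[chain t @^-1` _]setIT.
  by rewrite (noise_indep (@Ind_chain t))// probability_setT mule1 muleC setIT.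
rewrite fubini_tonelli1//.
by rewrite ge0_integral_distribution// => y; exact: integral_ge0.
Qed.

Let gam_pos t k a : has_gamma_law (gam t k) a 1 ->
  {ae P, forall w, (0 < gam t k w)%R}.
Proof.
move=> la; exists (gam t k @^-1` (~` `]0%R, +oo[)); split.
- by apply: measurable_gam; exact: measurableC.
- by rewrite -[LHS]/(distribution P (gam t k) _) (gamma_law_pos la).
- by move=> w /= /negP; rewrite -leNgt in_itv/= andbT => w0; apply/negP; rewrite -leNgt.
Qed.

Lemma prob_chain (u : nat -> {RV P >-> R}) t A : is_chain x b u0 gam u ->
  measurable A ->
  P (u t @^-1` A) =
  iter t (fun h y => \int[noise_prob m1 m2 m3]_g h (step x b y g))
    (fun y => (\1_A y)%:E) u0.
Proof.
move=> [u_0 uS] mA.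
have uchain : {ae P, forall w, u t w = chain t w}.
  elim: t => [|t IH]; first exact: u_0.
  apply: filterS3 _ (filterI IH (uS t)) (filterI (gam_pos (law1 (ltn0Sn t)))
    (gam_pos (law3 (ltn0Sn t)))) (gam_pos (law2 (ltn0Sn t))).
  move=> w /= [IHw ->] [p1 p3] p2.
  by rewrite /step /rate /G/= IHw !pos_id.
rewrite -mean_chain//; last by apply/measurable_EFinP; exact: measurable_indic.
have muA : measurable (u t @^-1` A) by exact: measurable_pre.
transitivity (\int[P]_w (\1_(u t @^-1` A) w)%:E).
  by rewrite integral_indic// setIT.
apply: ge0_ae_eq_integral => //.
- exact/measurable_EFinP/measurable_indic.
- apply/measurable_EFinP; apply: measurableT_comp (measurable_chain t).
  exact: measurable_indic.
- by apply: filterS uchain => w uw _; rewrite /= -uw.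
Qed.

End markov.

(** * Numerical bounds *)

Section numeric.
Context {R : realType}.

Lemma sinh_ge (h : R) : 0 <= h -> 2 * h <= expR h - expR (- h).
Proof.
move=> h0.
pose f (t : R) := expR t - expR (- t) - 2 * t.
have df (t : R) : is_derive t 1 f (expR t + expR (- t) - 2).
  rewrite /f; apply: is_derive_eq.
  by rewrite /GRing.scale/=; ring.
have f0 : f 0 = 0 by rewrite /f oppr0 mulr0 !subrr.
suff : f 0 <= f h by rewrite f0 /f subr_ge0.
apply: (@ger0_derive1_le_cc _ f 0 h) => //.
- move=> t _; rewrite derive1E; have [_ ->] := df t.
  have := expR_ge1Dx t; have := expR_ge1Dx (- t); lra.
- by apply: derivable_within_continuous => t _; have [] := df t.
- by rewrite in_itv/= lexx.
- by rewrite in_itv/= h0 lexx.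
Qed.

(** This is [h <= sinh h] at [h = - ln y / 2], where [2 * sinh h = (1 - y) / sqrt y]; squaring
    removes the root. *)
Lemma sqr_ln_le (y : R) : 0 < y <= 1 -> ln y ^+ 2 <= (1 - y) ^+ 2 / y.
Proof.
move=> /andP[y0 y1].
have L0 : 0 <= - ln y by rewrite oppr_ge0 ln_le0.
have := @sinh_ge (- ln y / 2); rewrite divr_ge0// => /(_ isT).
set e := expR _; set e' := expR _.
have ee : e * e' = 1 by rewrite /e /e' expRxMexpNx_1.
have e2 : e' ^+ 2 = y.
  rewrite /e' -expRM_natr -[RHS](lnK (x := y)) ?posrE//.
  by congr expR; field.
have e0 : 0 < e' by exact: expR_gt0.
have eV : e = e'^-1 by rewrite -[RHS]mul1r -ee mulfK// gt_eqF.
move=> H.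
have -> : (1 - y) ^+ 2 / y = (e - e') ^+ 2.
  by rewrite eV -e2; field; rewrite gt_eqF.
rewrite -sqrrN lerXn2r ?nnegrE//; last by lra.
by apply: le_trans H; lra.
Qed.

Lemma powR_pred (d y : R) : 0 < y -> y `^ d = y `^ (d - 1) * y.
Proof.
move=> y0; rewrite -[in RHS](powRr1 (ltW y0)).
rewrite -powRrM mul1r -powRD ?subrK//.
by apply/implyP => _; rewrite gt_eqF.
Qed.

(* [(1 - be) * (2 * be - 1) / (6 * be - 2)] is maximal at [be = 2 / 3], with
   value [1 / 18]. *)
Lemma rate_lower (be r : R) : 2^-1 < be ->
  (1 - r) * (6 * be - 2) <= (1 - be) * (2 * be - 1) -> 944 / 1000 <= r.
Proof.
move=> be2 hr; suff : 1 - r <= 56 / 1000 by lra.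
have b6 : 0 < 6 * be - 2 by lra.
rewrite -(ler_pM2r b6); apply: (le_trans hr).
have := sqr_ge0 (be - 666 / 1000); rewrite expr2; lra.
Qed.

(** For small [be] the bound [3 <= d] suffices. Otherwise the logarithm in [d] gives
    [be ^ (d - 1) <= |ln be| * r / 2], which passes to [th] through [th ^ 5 <= be ^ 2]; hence the
    claim is proved after raising it to the fifth power. *)
Lemma rate_power_le (be r d : R) : 2^-1 < be -> be < 1 -> r <= 1 ->
  (1 - r) * (6 * be - 2) <= (1 - be) * (2 * be - 1) ->
  3 <= d -> ln (be * `|ln be| * r / 2) / ln be <= d ->
  ((1 + be) / 2) `^ d <= r / 2.
Proof.
move=> be2 be1 r1 hr d3 hd.
have be0 : 0 < be by lra.
have r0 := rate_lower be2 hr.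
have rp : 0 < r by lra.
set th := (1 + be) / 2.
have th0 : 0 < th by rewrite /th; lra.
have th1 : th <= 1 by rewrite /th; lra.
(* The threshold serves both cases: below it [(31/40) ^ 3 < 0.944 / 2], above it
   [36/121 * (1 + be) <= 0.841 * be]. *)
have [be55|be55] := leP be (55 / 100).
  apply: (@le_trans _ _ (th `^ 3)); first by rewrite ger_powR// th0.
  rewrite powR_mulrn ?ltW//.
  have th7 : th <= 31 / 40 by rewrite /th; lra.
  have : th ^+ 2 <= 961 / 1600 by rewrite expr2; nra.
  move=> th2; have : th ^+ 3 <= 961 / 1600 * (31 / 40) by rewrite exprSr; nra.
  lra.
set L := `|ln be|.
have lnbe : ln be < 0 by rewrite ln_lt0// be0.
have Lp : 0 < L by rewrite normr_gt0 lt_eqF.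
have LE : L = - ln be by rewrite /L ltr0_norm.
have hbd : be `^ (d - 1) <= L * r / 2.
  have A0 : 0 < be * L * r / 2 by rewrite !mulr_gt0.
  have : be `^ d <= be * L * r / 2.
    rewrite /powR gt_eqF// -[leRHS]lnK ?posrE// ler_expR.
    by rewrite -ler_ndivrMr.
  rewrite powR_pred//.
  rewrite -ler_pdivlMr// => /le_trans; apply.
  by rewrite le_eqVlt; apply/orP; left; apply/eqP; field; rewrite gt_eqF.
(* By the arithmetic-geometric mean inequality [th] stays above [be ^ (1/2)], to which it is tangent
   at [be = 1]; the exponent 2/5 leaves enough room on this range. *)
have th5 : th ^+ 5 <= be ^+ 2.
  rewrite -subr_ge0; set z := 1 - be.
  have -> : be ^+ 2 - th ^+ 5 =
      z * (z ^+ 4 + z ^+ 2 * (5 - 10 * z) + (4 - 5 * z) * (4 - 7 * z)) / 32.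
    by rewrite /th /z; field.
  have z0 : 0 <= z by rewrite /z; lra.
  have z1 : z <= 45 / 100 by rewrite /z; lra.
  have p1 : 0 <= 5 - 10 * z by lra.
  have p2 : 0 <= 4 - 5 * z by lra.
  have p3 : 0 <= 4 - 7 * z by lra.
  by rewrite divr_ge0// mulr_ge0// !addr_ge0 ?mulr_ge0// exprn_ge0.
have L2 : L ^+ 2 <= (1 - be) ^+ 2 / be.
  by rewrite LE sqrrN; apply: sqr_ln_le; rewrite be0 ltW.
rewrite -(@ler_pXn2r _ 5) ?nnegrE ?powR_ge0//; last by lra.
rewrite (powR_pred d th0) mulrC exprMn.
have E2 : (th `^ (d - 1)) ^+ 5 <= (L * r / 2) ^+ 2.
  apply: (@le_trans _ _ ((be `^ (d - 1)) ^+ 2)); last first.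
    by rewrite lerXn2r ?nnegrE ?powR_ge0// !mulr_ge0// ltW.
  have swap (y : R) n : 0 < y -> (y `^ (d - 1)) ^+ n = (y ^+ n) `^ (d - 1).
    move=> y0; rewrite -(powR_mulrn n (powR_ge0 _ _)) -(powR_mulrn n (ltW y0)).
    by rewrite -!powRrM mulrC.
  rewrite !swap//.
  have d1 : 0 <= d - 1 by lra.
  by apply: (ge0_ler_powR d1) => //; rewrite nnegrE exprn_ge0// ltW.
apply: (@le_trans _ _ (th ^+ 5 * (L * r / 2) ^+ 2)).
  by rewrite ler_wpM2l// exprn_ge0// ltW.
have : 8 * th ^+ 5 * L ^+ 2 <= r ^+ 3.
  apply: (@le_trans _ _ (8 * th ^+ 5 * ((1 - be) ^+ 2 / be))).
    by rewrite ler_wpM2l// mulr_ge0// exprn_ge0// ltW.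
  have -> : 8 * th ^+ 5 * ((1 - be) ^+ 2 / be) =
      (1 + be) * ((1 + be) ^+ 2 * (1 - be)) ^+ 2 / 4 / be.
    by rewrite /th; field; rewrite gt_eqF.
  set A := (1 + be) ^+ 2 * (1 - be).
  (* This cubic decreases for [be > 1/3], and its value at 0.55 is just below 12/11. *)
  have A1 : A <= 12 / 11 by rewrite /A; nra.
  have A0 : 0 <= A by rewrite /A mulr_ge0 ?exprn_even_ge0// subr_ge0 ltW.
  have A2 : A ^+ 2 <= 144 / 121 by rewrite expr2; nra.
  have r2 : 891 / 1000 <= r ^+ 2 by rewrite expr2; nra.
  have r3 : 841 / 1000 <= r ^+ 3 by rewrite exprS; nra.
  rewrite ler_pdivrMr//.
  apply: (@le_trans _ _ (841 / 1000 * be)); last by rewrite ler_wpM2r// ltW.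
  apply: (@le_trans _ _ ((1 + be) * (144 / 121) / 4)); last by lra.
  rewrite ler_pM2r; last by lra.
  rewrite ler_wpM2l; last exact: A2.
    by [].
  by lra.
move=> H.
have -> : th ^+ 5 * (L * r / 2) ^+ 2 = 8 * th ^+ 5 * L ^+ 2 * (r ^+ 2 / 32).
  by field.
have -> : (r / 2) ^+ 5 = r ^+ 3 * (r ^+ 2 / 32) by field.
by rewrite ler_wpM2r// mulr_ge0// exprn_ge0// ltW.
Qed.

End numeric.

(** * Coupling *)

Definition lyapunov {R : realType} (u : R) : R := u + u^-1.

Section coupling.
Local Open Scope ereal_scope.
Context {R : realType}.
Variables (x b s eta beta r : R) (nu : probability (R * R * R)%type R).
Hypotheses (x0 : (0 < x)%R) (b0 : (0 < b)%R) (s0 : (0 <= s)%R)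
  (eta0 : (0 < eta)%R) (beta0 : (0 <= beta)%R) (beta1 : (beta <= 1)%R)
  (r0 : (0 <= r)%R).

Local Notation m := (Num.min x b).
Local Notation J := (@lyapunov R).
Local Notation K := (fun h y => \int[nu]_g h (step x b y g)).
Local Notation th := ((1 + beta) / 2)%R.

Hypothesis drift : forall u : R, (0 < u)%R ->
  \int[nu]_g (J (step x b u g))%:E <= (beta * Num.max (J u) eta)%:E.
Hypothesis contraction : forall u : R, (0 < u)%R -> (J u <= eta)%R ->
  (u / (u + m) <= r)%R.
Hypothesis one_step : forall (u w : R) (f : R -> \bar R), (0 < u)%R ->
  (u <= w)%R -> measurable_fun setT f -> (forall t, 0 <= f t <= 1) ->
  K f u <= K f w + (s * ((w - u) / (u + m)))%:E.

Let m0 : (0 < m)%R.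
Proof. by rewrite lt_min x0. Qed.

Let step_mono (u w : R) g : (0 < u)%R -> (u <= w)%R ->
  (step x b u g <= step x b w g)%R.
Proof.
move=> u0 uw; have w0 := lt_le_trans u0 uw.
have /andP[rr _] := rate_ratio_le x0 b0 g.1 u0 uw.
by rewrite ler_pM2l ?pos_gt0// lef_pV2 ?posrE ?rate_gt0.
Qed.

Let step_ratio (u w : R) g : (0 < u)%R -> (u <= w)%R ->
  (step x b w g / step x b u g - 1 <= u / (u + m) * (w / u - 1))%R.
Proof.
move=> u0 uw; have w0 := lt_le_trans u0 uw.
have /andP[_ rr] := rate_ratio_le x0 b0 g.1 u0 uw.
have ru := rate_gt0 x0 b0 g.1 u0; have rw := rate_gt0 x0 b0 g.1 w0.
have um : (0 < u + m)%R by exact: addr_gt0.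
have pg := pos_gt0 g.2.
have -> : (u / (u + m) * (w / u - 1) = (w + m) / (u + m) - 1)%R.
  by field; rewrite !gt_eqF.
rewrite lerB// /step.
have -> : (pos g.2 / rate x b w g.1 / (pos g.2 / rate x b u g.1) =
    rate x b u g.1 / rate x b w g.1)%R by field; rewrite !gt_eqF.
by rewrite ler_pdivrMr// mulrC.
Qed.

Let mJ u : measurable_fun setT (fun g => (J (step x b u g))%:E).
Proof.
have ms := measurable_step_fix x b u.
apply/measurable_EFinP; apply: measurable_funD => //.
by apply: measurableT_comp => //; exact: measurable_invr.
Qed.

Let J_gt0 (u : R) : (0 < u)%R -> (0 < J u)%R.
Proof. by move=> u0; rewrite /lyapunov addr_gt0// invr_gt0. Qed.

Let measurable_K h : measurable_fun setT h -> (forall y, 0 <= h y) ->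
  measurable_fun setT (K h).
Proof.
move=> mh h0.
have mhs : measurable_fun setT (fun z : R * (R * R * R) => h (step x b z.1 z.2)).
  by apply: measurableT_comp => //; exact: measurable_step.
exact: (@measurable_fun_fubini_tonelli_F _ _ R (R * R * R)%type R
    nu _ mhs (fun z => h0 _)).
Qed.

Let K_le1 h u : measurable_fun setT h -> (forall y, 0 <= h y <= 1) -> 0 <= K h u <= 1.
Proof.
move=> mh h01.
have mhs : measurable_fun setT (fun g => h (step x b u g)).
  by apply: measurableT_comp => //; exact: measurable_step_fix.
apply/andP; split.
  by apply: integral_ge0 => g _; have /andP[] := h01 (step x b u g).
apply: (@le_trans _ _ (\int[nu]_g 1)).
  apply: ge0_le_integral => //.
  - by move=> g _; have /andP[] := h01 (step x b u g).
  - by move=> g _; have /andP[] := h01 (step x b u g).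
by rewrite integral_cst// mul1e; exact: probability_le1.
Qed.

(** The inductive step of the coupling bounds: a common [g] preserves the order, the hypothesis is
    applied under the integral, and an error affine in the new [J] is averaged by the drift. *)
Let K_coupling (h : R -> \bar R) (B : R -> R -> R) (c1 c2 u w : R) :
  (0 < u)%R -> (u <= w)%R -> (0 <= c1)%R -> (0 <= c2)%R ->
  measurable_fun setT h -> (forall y, 0 <= h y) ->
  (forall u' w' : R, (0 < u')%R -> (u' <= w')%R -> h u' <= h w' + (B u' w')%:E) ->
  (forall g, (B (step x b u g) (step x b w g) <= c1 + c2 * J (step x b u g))%R) ->
  K h u <= K h w + (c1 + c2 * (beta * Num.max (J u) eta))%:E.
Proof.
move=> u0 uw c10 c20 mh h0 hB HB; have w0 := lt_le_trans u0 uw.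
have mhs v : measurable_fun setT (fun g => h (step x b v g)).
  by apply: measurableT_comp => //; exact: measurable_step_fix.
have J0 g : 0 <= (J (step x b u g))%:E.
  by rewrite lee_fin ltW// J_gt0// step_gt0.
have mc2 : measurable_fun setT (fun g => c2%:E * (J (step x b u g))%:E).
  exact: measurable_funeM.
apply: (@le_trans _ _ (\int[nu]_g (h (step x b w g) +
    (cst c1%:E g + c2%:E * (J (step x b u g))%:E)))).
  apply: ge0_le_integral => //.
  - by apply: emeasurable_funD => //; exact: emeasurable_funD.
  move=> g _; apply: le_trans (hB _ _ (step_gt0 x0 b0 g u0) (step_mono g u0 uw)) _.
  by rewrite leeD2l// /cst -EFinM -EFinD lee_fin HB.
rewrite ge0_integralD//; last 2 first.
- by move=> g _; rewrite adde_ge0// ?mule_ge0// lee_fin.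
- exact: emeasurable_funD.
rewrite leeD2l// ge0_integralD//; last by move=> g _; rewrite mule_ge0// lee_fin.
rewrite EFinD; apply: leeD.
  rewrite integral_cst// -[leRHS]mule1.
  by apply: lee_wpmul2l; [rewrite lee_fin|exact: probability_le1].
rewrite ge0_integralZl// EFinM; apply: lee_wpmul2l; first by rewrite lee_fin.
exact: drift.
Qed.

Variable f : R -> \bar R.
Hypotheses (mf : measurable_fun setT f) (f01 : forall y, 0 <= f y <= 1).

Local Notation It k := (iter k K f).

Let Itm k : measurable_fun setT (It k) /\ forall y, 0 <= It k y <= 1.
Proof.
elim: k => [//|k [mk k01]]; split => /=; last by move=> y; exact: K_le1.
by apply: measurable_K => // y; have /andP[] := k01 y.
Qed.

Let It0 k y : 0 <= It k y.
Proof. by have [_ /(_ y)/andP[]] := Itm k. Qed.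

Let It1 k y : It k y <= 1.
Proof. by have [_ /(_ y)/andP[]] := Itm k. Qed.

Let phi (u : R) := (u / (u + m))%R.

Let phi_ge0 (u : R) : (0 < u)%R -> (0 <= phi u)%R.
Proof. by move=> u0; rewrite divr_ge0// ltW// addr_gt0. Qed.

Let phi_le1 (u : R) : (0 < u)%R -> (phi u <= 1)%R.
Proof. by move=> u0; rewrite ler_pdivrMr ?addr_gt0// mul1r lerDl ltW. Qed.

Let ratio_ge0 (u w : R) : (0 < u)%R -> (u <= w)%R -> (0 <= w / u - 1)%R.
Proof. by move=> u0 uw; rewrite subr_ge0 ler_pdivlMr// mul1r. Qed.

(** The rescaling acts on the first of the [k.+1] steps and treats the others as the test function
    [It k]. Since [(w - u) / (u + m)] equals [phi u * (w / u - 1)], this step contracts as well. *)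
Let oneshot_ratio k (u w : R) : (0 < u)%R -> (u <= w)%R ->
  It k.+1 u <= It k.+1 w + (s * (phi u * (w / u - 1)))%:E.
Proof.
move=> u0 uw; have [mk k01] := Itm k.
apply: le_trans (one_step u0 uw mk k01) _ => /=.
rewrite leeD2l// lee_fin ler_wpM2l// le_eqVlt; apply/orP; left; apply/eqP.
by rewrite /phi; field; rewrite !gt_eqF// addr_gt0.
Qed.

Lemma coupling_no_contraction k (u w : R) : (0 < u)%R -> (u <= w)%R ->
  It k.+1 u <= It k.+1 w + (s * (w / u - 1))%:E.
Proof.
move=> u0 uw; apply: le_trans (oneshot_ratio k u0 uw) _.
rewrite leeD2l// lee_fin ler_wpM2l// ler_piMl ?phi_le1// ratio_ge0//.
Qed.

(* From a visit, where [w_] is 1, the expected next value of [w_] is at most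
   [1 + beta = 2 * th]; the factor 2 is absorbed by [2 ^+ n] since [n] drops. *)
Let w_ (u : R) : R := if (J u <= eta)%R then 1%R else (1 + J u / eta)%R.

Let w_gt (u : R) : (eta < J u)%R -> w_ u = (1 + J u / eta)%R.
Proof. by rewrite /w_ leNgt => ->. Qed.

Let w_le (u : R) : (0 < u)%R -> (w_ u <= 1 + J u / eta)%R.
Proof.
move=> u0; rewrite /w_; case: ifPn => // _.
by rewrite lerDl divr_ge0// ltW// J_gt0.
Qed.

Let w_ge1 (u : R) : (0 < u)%R -> (1 <= w_ u)%R.
Proof.
move=> u0; rewrite /w_; case: ifPn => // _.
by rewrite lerDl divr_ge0// ltW// J_gt0.
Qed.

Let th_ge0 : (0 <= th)%R.
Proof. by rewrite divr_ge0// addr_ge0. Qed.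

(* The number of visits to [J <= eta] dominates a binomial variable, whence the
   generating function bound with weight [1/2] per visit and rate [th]. *)
Lemma coupling_visits k n (u w : R) : (0 < u)%R -> (u <= w)%R ->
  It k.+1 u <= It k.+1 w +
    (s * r ^+ n * (w / u - 1) + 2 ^+ n / 4 * th ^+ k * w_ u)%:E.
Proof.
elim: k n u w => [|k IH] [|n] u w u0 uw.
- apply: le_trans (coupling_no_contraction _ u0 uw) _; rewrite leeD2l// lee_fin.
  by rewrite !expr0 mulr1 lerDl !mulr_ge0// ?(le_trans ler01 (w_ge1 u0)).
- rewrite expr0 mulr1.
  have R0 := ratio_ge0 u0 uw.
  have sR : (0 <= s * r ^+ n.+1 * (w / u - 1))%R by rewrite !mulr_ge0// exprn_ge0.
  have triv : (1 <= s * r ^+ n.+1 * (w / u - 1) + 2 ^+ n.+1 / 4 * w_ u)%R ->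
      It 1 u <= It 1 w +
        (s * r ^+ n.+1 * (w / u - 1) + 2 ^+ n.+1 / 4 * w_ u)%:E.
    move=> H; apply: (@le_trans _ _ 1); first exact: It1.
    by rewrite -[leLHS]add0e; apply: leeD => //; rewrite lee_fin.
  (* The factor 1/4 is tuned to this case: the error reaches 1 for a budget of one off a visit,
     where [w_ u >= 2], and for a budget of at least two anywhere. A budget of one at a visit is met
     by the contraction in the rescaling step. *)
  case: n sR triv => [|n] sR triv.
    have [Ju|Ju] := leP (J u) eta; last first.
      apply: triv; rewrite -[leLHS]add0r; apply: lerD => //.
      have : (1 <= J u / eta)%R by rewrite ler_pdivlMr// mul1r ltW.
      by rewrite w_gt// expr1; lra.
    apply: le_trans (oneshot_ratio _ u0 uw) _; rewrite leeD2l// lee_fin.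
    rewrite expr1 -[leLHS]addr0; apply: lerD.
      by rewrite -mulrA ler_wpM2l// ler_wpM2r// contraction.
    by rewrite mulr_ge0// (le_trans ler01 (w_ge1 u0)).
  apply: triv; rewrite -[leLHS]add0r; apply: lerD => //.
  have : (1 <= 2 ^+ n :> R)%R by rewrite exprn_ege1// ler1n.
  by have := w_ge1 u0; rewrite !exprS; nra.
- apply: le_trans (coupling_no_contraction _ u0 uw) _; rewrite leeD2l// lee_fin.
  rewrite expr0 mulr1 lerDl !mulr_ge0// ?exprn_ge0//.
  exact: le_trans ler01 (w_ge1 u0).
have [mk k01] := Itm k.+1.
have R0 := ratio_ge0 u0 uw.
(* The number of contractions still to be collected drops only at a visit. *)
pose N := if (J u <= eta)%R then n else n.+1.
pose c := (2 ^+ N / 4 * th ^+ k)%R.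
have c0 : (0 <= c)%R by rewrite !mulr_ge0// exprn_ge0.
have rN : (0 <= s * r ^+ N)%R by rewrite mulr_ge0// exprn_ge0.
apply: (le_trans (K_coupling (c1 := (s * r ^+ N * (phi u * (w / u - 1)) + c)%R)
    (c2 := (c / eta)%R) u0 uw _ _ mk (It0 _) (IH N) _)).
- by rewrite addr_ge0// mulr_ge0// mulr_ge0// phi_ge0.
- by rewrite divr_ge0// ltW.
- move=> g; rewrite -addrA; apply: lerD.
    by rewrite ler_wpM2l// step_ratio.
  rewrite -/c (_ : c + _ = c * (1 + J (step x b u g) / eta))%R; last by ring.
  by rewrite ler_wpM2l// w_le// step_gt0.
rewrite leeD2l// lee_fin -addrA; apply: lerD.
  rewrite /N; case: ifPn => Ju.
    rewrite exprSr !mulrA -mulrA.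
    rewrite [leRHS](_ : _ = s * r ^+ n * (r * (w / u - 1)))%R; last by ring.
    by rewrite -!mulrA ler_wpM2l// ler_wpM2l ?exprn_ge0// !mulrA ler_wpM2r// contraction.
  by rewrite ler_wpM2l// ?mulr_ge0 ?exprn_ge0// ler_piMl// phi_le1.
have cE : (c + c / eta * (beta * Num.max (J u) eta) =
    c * (1 + beta * (Num.max (J u) eta / eta)))%R by ring.
rewrite cE /c /N /w_; case: ifPn => Ju.
  rewrite max_r// divff ?gt_eqF// mulr1 mulr1 le_eqVlt; apply/orP; left; apply/eqP.
  by rewrite !exprS; field.
have Jy : (1 <= J u / eta)%R by rewrite ler_pdivlMr// mul1r ltW// ltNge.
rewrite max_l; last by rewrite ltW// ltNge.
rewrite exprSr -!mulrA ler_wpM2l ?exprn_ge0// ler_wpM2l ?invr_ge0//.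
rewrite [(th ^+ k.+1)%R]exprSr -mulrA ler_wpM2l ?exprn_ge0//.
rewrite ler_wpM2l ?exprn_ge0//.
(* The two sides differ by [(1 - beta) * (y - 1) / 2]. *)
move: Jy (beta1); set y := (J u / eta)%R; nra.
Qed.

(* Waiting for the first visit costs [beta] per step; only the remaining [k]
   steps are charged at rate [th]. *)
Lemma coupling_hitting j k n (u w : R) : (0 < u)%R -> (u <= w)%R ->
  It (j + k).+1 u <= It (j + k).+1 w +
    (s * r ^+ n * (w / u - 1) + 2 ^+ n / 4 * th ^+ k +
     Num.max (J u) eta * beta ^+ j / eta)%:E.
Proof.
have th1 : (th <= 1)%R by rewrite ler_pdivrMr// mul1r; move: (beta1); lra.
suff H : forall u w : R, (0 < u)%R -> (u <= w)%R ->
    It (j + k).+1 u <= It (j + k).+1 w +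
    (s * r ^+ n * (w / u - 1) + 2 ^+ n / 4 * th ^+ k +
     (if (J u <= eta)%R then 0 else J u / eta * beta ^+ j))%:E.
  move=> u0 uw; apply: le_trans (H _ _ u0 uw) _; rewrite leeD2l// lee_fin.
  rewrite lerD2l; case: ifPn => Ju.
    by rewrite divr_ge0 ?(ltW eta0)// mulr_ge0 ?exprn_ge0// le_max (ltW eta0) orbT.
  have Ju' : (eta <= J u)%R by rewrite ltW// ltNge.
  by rewrite max_l// mulrAC.
(* After a hit with [j'] waiting steps to spare, these steps only help, because [th <= 1]. *)
move=> {u w}; have tail u w j' : (0 < u)%R -> (u <= w)%R -> (J u <= eta)%R ->
    It (j' + k).+1 u <= It (j' + k).+1 w +
      (s * r ^+ n * (w / u - 1) + 2 ^+ n / 4 * th ^+ k)%:E.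
  move=> u0 uw Ju; apply: le_trans (coupling_visits _ n u0 uw) _.
  rewrite leeD2l// lee_fin lerD2l /w_ Ju mulr1.
  rewrite ler_wpM2l ?divr_ge0 ?exprn_ge0// exprD ler_piMl ?exprn_ge0//.
  by rewrite exprn_ile1.
have c10 u w : (0 < u)%R -> (u <= w)%R ->
    (0 <= s * r ^+ n * (w / u - 1) + 2 ^+ n / 4 * th ^+ k)%R.
  move=> u0 uw; rewrite addr_ge0 ?mulr_ge0 ?exprn_ge0 ?ratio_ge0//.
elim: j => [|j IH] u w u0 uw.
  case: ifPn => Ju; first by rewrite addr0; exact: (tail _ _ 0%N).
  apply: (@le_trans _ _ 1); first exact: It1.
  rewrite -[leLHS]add0e; apply: leeD => //.
  rewrite lee_fin expr0 mulr1 -[leLHS]add0r; apply: lerD; first exact: c10.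
  by rewrite ler_pdivlMr// mul1r ltW// ltNge.
case: ifPn => Ju; first by rewrite addr0; exact: tail.
have [mk k01] := Itm (j + k).+1.
have R0 := ratio_ge0 u0 uw.
have sr0 : (0 <= s * r ^+ n)%R by rewrite mulr_ge0// exprn_ge0.
pose c1 := (s * r ^+ n * (phi u * (w / u - 1)) + 2 ^+ n / 4 * th ^+ k)%R.
have c2 : (0 <= beta ^+ j / eta)%R by rewrite divr_ge0 ?exprn_ge0// ltW.
have c1_ge0 : (0 <= c1)%R.
  apply: addr_ge0; last by rewrite !mulr_ge0 ?exprn_ge0.
  by apply: mulr_ge0 => //; apply: mulr_ge0 => //; exact: phi_ge0.
apply: (le_trans (K_coupling u0 uw c1_ge0 c2 mk (It0 _) IH _)).
  move=> g; apply: lerD.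
    by rewrite lerD2r ler_wpM2l// step_ratio.
  have sg := step_gt0 x0 b0 g u0.
  case: ifPn => _; last by rewrite le_eqVlt; apply/orP; left; apply/eqP; ring.
  by rewrite mulr_ge0// ltW// J_gt0.
rewrite leeD2l// lee_fin; apply: lerD.
  by rewrite lerD2r ler_wpM2l// ler_piMl// phi_le1.
rewrite max_l; last by rewrite ltW// ltNge.
by rewrite exprSr le_eqVlt; apply/orP; left; apply/eqP; ring.
Qed.

End coupling.

(** * The constants *)

Section constants_theory.
Context {R : realType}.
Variables x b a1 a2 a3 a4 : R.
Hypotheses (hx : 0 < x) (hb : 0 < b).
Hypotheses (ha1 : 0 < a1) (ha2 : 0 < a2) (ha3 : 0 < a3) (ha4 : 0 < a4).
Hypotheses (ha14 : 1 < a1 + a4) (ha23 : 1 < a2 + a3).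

Local Notation zeta := (czeta a1 a2 a3 a4).
Local Notation beta := (cbeta a1 a2 a3 a4).
Local Notation eta := (ceta x b a1 a2 a3 a4).
Local Notation r := (cr x b a1 a2 a3 a4).
Local Notation m := (Num.min x b).
Local Notation M := (Num.max x b).

Let N0 : 0 < a1 + a2 + a3 + a4 - 1.
Proof. by move: ha14 ha2 ha3; lra. Qed.

Local Ltac slra := move: (hx) (hb) (ha1) (ha2) (ha3) (ha4) (ha14) (ha23) (N0); lra.

Lemma czeta_gt0 : 0 < zeta.
Proof. by rewrite divr_gt0// addr_gt0. Qed.

Lemma czeta_lt1 : zeta < 1.
Proof. by rewrite ltr_pdivrMr//; move: ha14; lra. Qed.

Lemma cbeta_gt : 2^-1 < beta.
Proof. by rewrite /cbeta; have := czeta_gt0; lra. Qed.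

Lemma cbeta_lt1 : beta < 1.
Proof. by rewrite /cbeta; have := czeta_lt1; lra. Qed.

Let m0 : 0 < m.
Proof. by rewrite lt_min hx. Qed.

Let M0 : 0 < M.
Proof. by rewrite lt_max hx. Qed.

Let mM : m <= M.
Proof. by rewrite ge_min !le_max lexx. Qed.

(** The right side is the constant part of the drift bound. This is where [eta] and [beta] come
    from: [zeta * u + (1 - zeta) / 2 * eta] is at most [(1 + zeta) / 2] times the maximum of [J u]
    and [eta]. *)
Lemma ceta_split : (1 - zeta) / 2 * eta =
  (x + b) * zeta + ((a1 + a2) / x + (a3 + a4) / b) / (a2 + a3 - 1).
Proof.
rewrite /ceta /czeta; field.
by rewrite ?gt_eqF//=; slra.
Qed.

Lemma ceta_ge : M * zeta + (M * zeta)^-1 <= (1 - zeta) / 2 * eta.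
Proof.
rewrite ceta_split; have z0 := czeta_gt0; apply: lerD.
  rewrite ler_pM2r// ge_max; apply/andP; split; slra.
have Mi (y : R) : 0 < y -> y <= M -> M^-1 <= y^-1.
  by move=> y0 yM; rewrite lef_pV2 ?posrE.
have s1 : 0 < a2 + a3 - 1 by slra.
have xM : x <= M by rewrite le_max lexx.
have bM : b <= M by rewrite le_max lexx orbT.
apply: (@le_trans _ _ ((a1 + a2 + a3 + a4) / M / (a2 + a3 - 1))); last first.
  rewrite ler_pM2r ?invr_gt0// -addrA -(addrA a1) addrA.
  rewrite mulrDl lerD// ler_wpM2l ?Mi//; slra.
rewrite invfM -!mulrA [leRHS]mulrCA ler_pM2l ?invr_gt0//.
rewrite /czeta invf_div ler_pdivrMr ?addr_gt0// mulrAC ler_pdivlMr//.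
move: ha1 ha2 ha3 ha4 ha14 ha23 (M0); nra.
Qed.

Lemma ceta_gt0 : 0 < eta.
Proof.
have := ceta_ge; have z0 := czeta_gt0; have z1 := czeta_lt1.
have Mz : 0 < M * zeta by rewrite mulr_gt0.
have : 0 < (M * zeta)^-1 by rewrite invr_gt0.
have z2 : 0 < (1 - zeta) / 2 by slra.
move=> I0 H; rewrite -(pmulr_rgt0 _ z2); slra.
Qed.

Let den0 : 0 < 2 * M + eta * (1 + M ^+ 2).
Proof.
apply: addr_gt0; first exact: mulr_gt0.
by apply: mulr_gt0; [exact: ceta_gt0|apply: addr_gt0 => //; exact: exprn_gt0].
Qed.

Lemma cr_lt1 : r < 1.
Proof. by rewrite /cr ltrBlDr ltrDl divr_gt0. Qed.

(** Here [u / (u + m) = 1 - m / (u + m)], and [u + m <= eta + M] is below the denominator in [r]. *)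
Lemma cr_contraction (u : R) : 0 < u -> u <= eta -> u / (u + m) <= r.
Proof.
move=> u0 ue; have e0 := ceta_gt0.
have -> : u / (u + m) = 1 - m / (u + m) by field; rewrite gt_eqF// addr_gt0.
rewrite /cr lerD2l lerN2 ler_pM2l// lef_pV2 ?posrE ?den0 ?(addr_gt0 u0)//.
have : 0 <= eta * M ^+ 2 by rewrite mulr_ge0 ?exprn_ge0// ltW.
rewrite mulrDr mulr1; move: (mM) (M0) ue; slra.
Qed.

(** After [m <= M] and [ceta_ge], the remaining slack is the square [(M ^ 2 * zeta - 1) ^ 2 / M].
    The result keeps [r] close to 1 in the numerical bounds. *)
Lemma cr_large : (1 - r) * (6 * beta - 2) <= (1 - beta) * (2 * beta - 1).
Proof.
have z0 := czeta_gt0; have z1 := czeta_lt1.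
have -> : 1 - r = m / (2 * M + eta * (1 + M ^+ 2)).
  by rewrite /cr opprB addrC subrK.
rewrite mulrAC ler_pdivrMr//.
have -> : 6 * beta - 2 = 3 * zeta + 1 by rewrite /cbeta; field.
have -> : (1 - beta) * (2 * beta - 1) = (1 - zeta) / 2 * zeta.
  by rewrite /cbeta; field.
apply: (@le_trans _ _ (M * (3 * zeta + 1))); first by rewrite ler_wpM2r//; slra.
rewrite [leRHS]mulrDr.
have -> : (1 - zeta) / 2 * zeta * (eta * (1 + M ^+ 2)) =
  zeta * (1 + M ^+ 2) * ((1 - zeta) / 2 * eta) by ring.
have H : zeta * (1 + M ^+ 2) * (M * zeta + (M * zeta)^-1) <=
    zeta * (1 + M ^+ 2) * ((1 - zeta) / 2 * eta).
  by rewrite ler_pM2l ?ceta_ge// mulr_gt0// addr_gt0// exprn_gt0.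
apply: le_trans (lerD (lexx _) H).
rewrite -subr_ge0.
have -> : (1 - zeta) / 2 * zeta * (2 * M) +
    zeta * (1 + M ^+ 2) * (M * zeta + (M * zeta)^-1) - M * (3 * zeta + 1) =
    (M ^+ 2 * zeta - 1) ^+ 2 / M.
  by field; rewrite !gt_eqF.
by rewrite divr_ge0 ?sqr_ge0// ltW.
Qed.

End constants_theory.

(** * Conclusion *)

Section time_split.
Context {R : realType}.
Variables (th r d : R) (t : nat).
Hypotheses (d3 : 3 <= d) (r_ge : 3^-1 <= r) (r_le1 : r <= 1).

Local Notation X := (t%:R / (2 * d)).
Local Notation N := (Num.truncn X).

Let X0 : 0 <= X.
Proof. by rewrite divr_ge0// mulr_ge0// (le_trans _ d3). Qed.

Let rp : 0 < r.
Proof. by rewrite (lt_le_trans _ r_ge)// invr_gt0. Qed.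

(** Rounding the exponent down costs at most [1 / r <= 3], the origin of the 3 in the final
    bound. *)
Lemma expr_truncn_le : r ^+ N <= 3 * r `^ X.
Proof.
have /andP[_ XN] := truncn_itv X0.
have : r ^+ N.+1 <= r `^ X.
  by rewrite -powR_mulrn ?(ltW rp)// ger_powR ?rp// ltW.
rewrite exprS => H.
have : 3^-1 * r ^+ N <= r * r ^+ N by rewrite ler_wpM2r// exprn_ge0// ltW.
move: H; set A := r ^+ N; set B := r `^ X; lra.
Qed.

Hypotheses (th_ge : 3 / 4 <= th) (th_lt1 : th <= 1) (thd : th `^ d <= r / 2).

Let thp : 0 < th.
Proof. by move: (th_ge); lra. Qed.

(** One has [th ^ (d * X) <= (r / 2) ^ X], and [2 ^ N <= 2 ^ X] cancels the halves. As
    [d * X = t / 2] while the exponent of [th] may be only [t / 2 - 2], a factor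
    [th ^ (- 2) <= 16 / 9] is lost; the 1/4 absorbs it. *)
Lemma time_split_bound : (0 < N)%N ->
  (t./2 + 3 <= t.+1)%N /\
  2 ^+ N / 4 * th ^+ (t.+1 - (t./2 + 3)) <= r `^ X.
Proof.
move=> N0; have d0 : 0 < d by rewrite (lt_le_trans _ d3).
have t6 : (6 <= t)%N.
  rewrite -(@ler_nat R); move: N0; rewrite truncn_gt0 ler_pdivlMr ?mulr_gt0// mul1r.
  by apply: le_trans; move: (d3); lra.
split; first lia.
set k := (t.+1 - (t./2 + 3))%N.
have kd : d * X - 2 <= k%:R.
  have -> : d * X = t%:R / 2 by field; rewrite gt_eqF.
  have : (t <= 2 * (k + 2))%N by rewrite /k; lia.
  by rewrite -(@ler_nat R) natrM natrD; lra.
have H1 : th ^+ k * th ^+ 2 <= (r / 2) `^ X.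
  apply: (@le_trans _ _ (th `^ (d * X))).
    rewrite -!powR_mulrn ?(ltW thp)// -powRD; last first.
      by apply/implyP => _; rewrite gt_eqF.
    by rewrite ger_powR ?thp//; move: kd; lra.
  rewrite powRrM; apply: (ge0_ler_powR X0) => //; rewrite nnegrE ?powR_ge0//.
  by rewrite divr_ge0// ltW.
have H2 : 2 ^+ N <= 2 `^ X :> R.
  have /andP[NX _] := truncn_itv X0.
  by rewrite -powR_mulrn// ler_powR// ler1n.
have H3 : (r / 2) `^ X * 2 `^ X = r `^ X.
  by rewrite -powRM// ?divrK ?unitfE// divr_ge0// ltW.
have H4 : 9 / 16 <= th ^+ 2 by rewrite expr2; move: (th_ge); nra.
have P2 : 0 <= 2 ^+ N :> R by rewrite exprn_ge0.
have P1 : 0 <= th ^+ k by rewrite exprn_ge0// ltW.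
have P3 : 0 <= (r / 2) `^ X by exact: powR_ge0.
have H5 : 2 ^+ N * (th ^+ k * th ^+ 2) <= r `^ X.
  rewrite -H3 mulrC; apply: ler_pM => //.
  by rewrite mulr_ge0// exprn_ge0// ltW.
apply: le_trans H5.
have -> : 2 ^+ N / 4 * th ^+ k = 2 ^+ N * (th ^+ k * 4^-1) :> R by ring.
rewrite ler_wpM2l// ler_wpM2l//; lra.
Qed.

End time_split.

(** The hypothesis at the complement of [A] is the reverse inequality. *)
Lemma dTV_le d1 d2 (T1 : measurableType d1) (T2 : measurableType d2)
    (R : realType) (P : probability T1 R) (Q : probability T2 R)
    (X : {RV P >-> R}) (Y : {RV Q >-> R}) (e : R) :
  (forall A, measurable A -> P (X @^-1` A) <= Q (Y @^-1` A) + e%:E)%E ->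
  (dTV X Y <= e%:E)%E.
Proof.
move=> H; apply: ge_ereal_sup => _ [A mA <-].
have mX : measurable (X @^-1` A) by exact: measurable_sfunP.
have mY : measurable (Y @^-1` A) by exact: measurable_sfunP.
have := H A mA; have := H _ (measurableC mA).
have -> : (P (X @^-1` (~` A)) = 1 - P (X @^-1` A))%E := probability_setC P mX.
have -> : (Q (Y @^-1` (~` A)) = 1 - Q (Y @^-1` A))%E := probability_setC Q mY.
rewrite -(fineK (fin_num_measure P _ mX)) -(fineK (fin_num_measure Q _ mY)).
rewrite -!EFinB -!EFinD !lee_fin /= => H1 H2.
by rewrite ler_norml; apply/andP; split; lra.
Qed.

Unset Implicit Arguments.

Theorem theorem16 (R : realType) (x b a1 a2 a3 a4 : R)
    (hx : 0 < x) (hb : 0 < b)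
    (ha1 : 0 < a1) (ha2 : 0 < a2) (ha3 : 0 < a3) (ha4 : 0 < a4)
    (ha14 : 1 < a1 + a4) (ha23 : 1 < a2 + a3)
    (d1 d2 : measure_display)
    (T1 : measurableType d1) (T2 : measurableType d2)
    (P : probability T1 R) (Q : probability T2 R)
    (gam : nat -> nat -> {RV P >-> R}) (gam' : nat -> nat -> {RV Q >-> R})
    (u0 w0 : R) (u : nat -> {RV P >-> R}) (w : nat -> {RV Q >-> R})
    (hgam : gamma_noise a1 a2 a3 a4 gam) (hgam' : gamma_noise a1 a2 a3 a4 gam')
    (hu0 : 0 < u0) (hw0 : 0 < w0) (huw : u0 <= w0)
    (hu : is_chain x b u0 gam u) (hw : is_chain x b w0 gam' w) :
  let eta := ceta x b a1 a2 a3 a4 in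
  let beta := cbeta a1 a2 a3 a4 in
  let r := cr x b a1 a2 a3 a4 in
  let d := cd x b a1 a2 a3 a4 in
  let R0 := w0 / u0 in
  let J0 := u0 + u0^-1 in
  forall t : nat,
    (dTV (u t.+2) (w t.+2) <=
      (r `^ (t%:R / (2 * d)) * (1 + 3 * (a2 + a3) * (R0 - 1)) +
       Num.max J0 eta * beta ^+ (t./2 + 3) / eta)%:E)%E.
Proof.
move=> eta beta r d R0 J0 t.
have s1 : 0 <= a2 + a3 by lra.
have pq1 : 1 < a1 + a2 + (a3 + a4) by lra.
have eta0 : 0 < eta by exact: ceta_gt0.
have be2 : 2^-1 < beta by exact: cbeta_gt.
have be1 : beta < 1 by exact: cbeta_lt1.
have be0 : 0 < beta by lra.
have r1 : r < 1 by exact: cr_lt1.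
have rl : (1 - r) * (6 * beta - 2) <= (1 - beta) * (2 * beta - 1).
  exact: cr_large.
have r9 := rate_lower be2 rl.
have d3 : 3 <= d by rewrite le_max lexx.
have thd : ((1 + beta) / 2) `^ d <= r / 2.
  by apply: rate_power_le => //; [exact: ltW|rewrite le_max lexx orbT].
have [indX laws] := hgam; have [indX' laws'] := hgam'.
have law1 k : (1 <= k)%N -> has_gamma_law (gam k 1%N) (a1 + a2) 1.
  by move=> /laws[].
have law2 k : (1 <= k)%N -> has_gamma_law (gam k 2%N) (a2 + a3) 1.
  by move=> /laws[].
have law3 k : (1 <= k)%N -> has_gamma_law (gam k 3%N) (a3 + a4) 1.
  by move=> /laws[].
have law1' k : (1 <= k)%N -> has_gamma_law (gam' k 1%N) (a1 + a2) 1.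
  by move=> /laws'[].
have law2' k : (1 <= k)%N -> has_gamma_law (gam' k 2%N) (a2 + a3) 1.
  by move=> /laws'[].
have law3' k : (1 <= k)%N -> has_gamma_law (gam' k 3%N) (a3 + a4) 1.
  by move=> /laws'[].
(* Both noises have the same Gamma laws, so the laws read off from [P] also describe the chain on
   [Q]. *)
pose m1 : probability R R := distribution P (gam 1%N 1%N).
pose m2 : probability R R := distribution P (gam 1%N 2%N).
pose m3 : probability R R := distribution P (gam 1%N 3%N).
have m1E : forall A, measurable A -> m1 A = gamma_prob (a1 + a2) 1 A.
  exact: law1.
have m2E : forall A, measurable A -> m2 A = gamma_prob (a2 + a3) 1 A.
  exact: law2.
have m3E : forall A, measurable A -> m3 A = gamma_prob (a3 + a4) 1 A.
  exact: law3.
apply: dTV_le => A mA.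
rewrite (prob_chain m1E m2E m3E indX law1 law2 law3 _ hu mA).
rewrite (prob_chain m1E m2E m3E indX' law1' law2' law3' _ hw mA).
have mf : measurable_fun setT (fun y : R => (\1_A y : R)%:E).
  by apply/measurable_EFinP; exact: measurable_indic.
have f01 (y : R) : (0 <= (\1_A y : R)%:E <= 1)%E.
  by rewrite !lee_fin indicE; case: (_ \in _); rewrite ?lexx ler01.
have one_step (u' w' : R) (f : R -> \bar R) : 0 < u' -> u' <= w' ->
    measurable_fun setT f -> (forall y, 0 <= f y <= 1)%E ->
    (\int[noise_prob m1 m2 m3]_g f (step x b u' g) <=
    \int[noise_prob m1 m2 m3]_g f (step x b w' g) +
    ((a2 + a3) * ((w' - u') / (u' + Num.min x b)))%:E)%E.
  exact: oneshot.
have drift (u' : R) : 0 < u' ->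
    (\int[noise_prob m1 m2 m3]_g (lyapunov (step x b u' g))%:E <=
      (beta * Num.max (lyapunov u') eta)%:E)%E.
  move=> u'0; apply: le_trans (mean_step_le hx hb (ltW (addr_gt0 ha1 ha2))
    (ltW (addr_gt0 ha3 ha4)) ha23 pq1 m1E m2E m3E u'0) _.
  have z1 := czeta_lt1 ha2 ha3 ha14.
  have zs := ceta_split hx hb ha1 ha2 ha3 ha4 ha14 ha23.
  have z0 := czeta_gt0 ha2 ha3 ha14.
  have -> : (a2 + a3) * (u' + x + b) / (a1 + a2 + (a3 + a4) - 1) =
      czeta a1 a2 a3 a4 * u' + (x + b) * czeta a1 a2 a3 a4.
    by rewrite /czeta (addrA (a1 + a2)); ring.
  rewrite -addrA -zs lee_fin.
  have uJ : u' <= Num.max (lyapunov u') eta.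
    by rewrite le_max lerDl invr_ge0 ltW.
  have eJ : eta <= Num.max (lyapunov u') eta by rewrite le_max lexx orbT.
  rewrite /beta /cbeta; move: uJ eJ z0 z1.
  set mu := Num.max _ _; set z := czeta _ _ _ _; rewrite -/eta => uJ eJ z0 z1.
  nra.
have contraction (u' : R) : 0 < u' -> lyapunov u' <= eta ->
    u' / (u' + Num.min x b) <= r.
  move=> u'0 Ju'; apply: cr_contraction => //; apply: le_trans Ju'.
  by rewrite lerDl invr_ge0 ltW.
have R0_ge : 0 <= w0 / u0 - 1 by rewrite subr_ge0 ler_pdivlMr// mul1r.
have sR0 : 0 <= (a2 + a3) * (w0 / u0 - 1) by rewrite mulr_ge0.
have tail0 j : 0 <= Num.max J0 eta * beta ^+ j / eta.
  rewrite !mulr_ge0 ?exprn_ge0 ?invr_ge0 ?(ltW be0) ?(ltW eta0)//.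
  by rewrite le_max (ltW eta0) orbT.
have rN : r ^+ Num.truncn (t%:R / (2 * d)) <= 3 * r `^ (t%:R / (2 * d)).
  apply: expr_truncn_le => //; lra.
have rX := powR_ge0 r (t%:R / (2 * d)).
have main n : r ^+ n <= 3 * r `^ (t%:R / (2 * d)) ->
    (a2 + a3) * r ^+ n * (w0 / u0 - 1) <=
    r `^ (t%:R / (2 * d)) * (3 * (a2 + a3) * (R0 - 1)).
  move=> rn; apply: (@le_trans _ _ ((3 * r `^ (t%:R / (2 * d))) *
      ((a2 + a3) * (w0 / u0 - 1)))).
    by rewrite mulrAC mulrC ler_wpM2r.
  by rewrite le_eqVlt; apply/orP; left; apply/eqP; rewrite /R0; ring.
(* If the truncation is 0, then [1 <= 3 * r ^ X] and the bound without contraction suffices;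
   otherwise [t >= 6] and the time can be split. *)
have [N0|N0] := posnP (Num.truncn (t%:R / (2 * d))).
  apply: le_trans (coupling_no_contraction hx hb s1 one_step mf f01 t.+1 hu0 huw) _.
  rewrite leeD2l// lee_fin.
  have := main 0%N; rewrite -{1}N0 => /(_ rN); rewrite expr0 mulr1 => H.
  rewrite (mulrDr (r `^ _) 1) mulr1.
  by rewrite -[leLHS]addr0; apply: lerD => //; apply: (le_trans H); rewrite lerDr.
clearbody eta beta r d.
have r3 : 3^-1 <= r by lra.
have r0 : 0 <= r by lra.
have th1 : 3 / 4 <= (1 + beta) / 2 by lra.
have th2 : (1 + beta) / 2 <= 1 by lra.
have [j1 k1] := time_split_bound d3 r3 (ltW r1) th1 th2 thd N0.
have jk := subnKC j1.
move: k1 jk rN; set k := (t.+1 - (t./2 + 3))%N; set N := Num.truncn _ => k1 jk rN.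
(* Of the [t + 2] steps, [t./2 + 3] are for waiting, [k] for contracting, and the last one is the
   rescaling. *)
have H := coupling_hitting hx hb s1 eta0 (ltW be0) (ltW be1) r0 drift contraction
  one_step mf f01 (t./2 + 3) k N hu0 huw.
rewrite jk in H.
apply: (le_trans H).
rewrite leeD2l// lee_fin; have M := main _ rN.
rewrite (mulrDr (r `^ _) 1) mulr1 [r `^ _ + _]addrC.
by apply: lerD => //; apply: lerD.
Qed.
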